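(* Let $\{X_1,\ldots,X_n\}$ be a simple random sample of size $n$ from a collection $\mathcal{A}$ of $N$ real numbers, not all equal, with $n$ and $N$ satisfying $$2<n<N-1.$$ Let $Y=\sum_{i=1}^nX_i$, and let $$\bar a=\frac1N\sum_{a\in\mathcal{A}}a,\qquad\mu=n\bar a,\qquad\sigma^2=\frac{n(N-n)}{N(N-1)}\sum_{a\in\mathcal{A}}(a-\bar a)^2,\qquad a_3=\sum_{a\in\mathcal{A}}|a-\bar a|^3$$ (so that $\mu=EY$ and $\sigma^2=\mathrm{Var}(Y)$). Then the distribution function $F$ of the standardized variable $W=(Y-\mu)/\sigma$ satisfies $$\|F-\Phi\|_1\le\frac{4a_3}{\sigma^3}\left(\frac{n(N-n)}{N(N-1)}\right)\left(1+\frac nN\right)^2,$$ where $\Phi$ is the standard normal distribution function.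
   Context: For distribution functions $F,G$ on $\mathbf{R}$, $\|F-G\|_1=\int_{-\infty}^\infty|F(t)-G(t)|\,dt$. Simple random sampling: a subset of $n$ of the $N$ members of $\mathcal{A}$ is chosen uniformly, that is, each subset with probability $\binom Nn^{-1}$ (sampling without replacement). The numbers in $\mathcal{A}$ may contain repetitions: members are treated as distinguishable by labels, and sums over $a\in\mathcal{A}$ run over all $N$ members with multiplicity. *)

(* Defs.v *)
From HB Require Import structures.
From mathcomp Require Import all_boot all_order all_algebra.
From mathcomp Require Import all_classical all_reals all_analysis.
Import Order.TTheory GRing.Theory Num.Theory numFieldNormedType.Exports.

Set Implicit Arguments.
Unset Strict Implicit.
Unset Printing Implicit Defensive.

Local Open Scope classical_set_scope.
Local Open Scope ring_scope.

(* A finite powerset carries the discrete sigma-algebra, so that random subsets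
   are random variables in the sense of the library. *)
HB.instance Definition _ (T : finType) := isPointed.Build {set T} finset.set0.
HB.instance Definition _ (T : finType) :=
  @isMeasurable.Build default_measure_display {set T}
    (@discrete_measurable {set T}) (@discrete_measurable0 {set T})
    (@discrete_measurableC {set T}) (@discrete_measurableU {set T}).

(* The collection is a family a : 'I_N -> R, so that repeated values remain
   distinguishable by their labels; a sample is the random set of the labels of
   the chosen members. The sets of cardinality other than n then have
   probability 0, because there are 'C(N, n) sets of cardinality n. *)
Definition simple_random_sample (R : realType) (d : measure_display)
    (T : measurableType d) (P : probability T R) (N n : nat)
    (S : {RV P >-> {set 'I_N}}) : Prop :=
  forall B : {set 'I_N}, #|B| = n ->
    P (S @^-1` [set B]) = (('C(N, n)%:R)^-1)%:E.

Section population.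
Context {R : realType} {N : nat}.
Variables (n : nat) (a : 'I_N -> R).

Definition pop_mean : R := N%:R^-1 * \sum_i a i.

Definition pop_a3 : R := \sum_i `|a i - pop_mean| ^+ 3.

Definition sample_mu : R := n%:R * pop_mean.

Definition sample_sigma2 : R :=
  n%:R * (N%:R - n%:R) / (N%:R * (N%:R - 1)) *
    \sum_i (a i - pop_mean) ^+ 2.

Definition sample_sigma : R := Num.sqrt sample_sigma2.

Definition sample_sum (B : {set 'I_N}) : R := \sum_(i in B) a i.

Definition standardized_sum (B : {set 'I_N}) : R :=
  (sample_sum B - sample_mu) / sample_sigma.

Lemma measurable_standardized_sum : measurable_fun setT standardized_sum.
Proof. by []. Qed.

HB.instance Definition _ := @isMeasurableFun.Build _ _ {set 'I_N}
  R standardized_sum measurable_standardized_sum.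

End population.

Definition std_normal_cdf (R : realType) (t : R) : \bar R :=
  normal_prob 0 1 `]-oo, t].

Definition L1_dist (R : realType) (F G : R -> \bar R) : \bar R :=
  (\int[lebesgue_measure]_t `|F t - G t|)%E.

(* Main.v *)
Require Import Defs.
From HB Require Import structures.
From mathcomp Require Import all_boot all_order all_algebra.
From mathcomp Require Import all_classical all_reals all_analysis.
From mathcomp Require Import measurable_realfun zify ring lra.
Import Order.TTheory GRing.Theory Num.Theory numFieldNormedType.Exports.

Set Implicit Arguments.
Unset Strict Implicit.
Unset Printing Implicit Defensive.

Local Open Scope classical_set_scope.
Local Open Scope ring_scope.

(* Stein's method.  With [s = sgn (F - Phi)], the L1 distance is
   [\int s (F - Phi) = E (H' W - W * H W)], where [H] solves Stein's equation
   and [H'] is 2-Lipschitz.  Write [b] for the standardized population, [C] for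
   a uniform subset of size [n - 1] avoiding two labels [i] and [j], and [w] for
   the sum of [b] over a subset.  Exchanging [i] and [j] expresses [E (W * H W)]
   as an average of [(b i - b j) * (H (w C + b i) - H (w C + b j))], while [H' W]
   is averaged against the weights [(b i - b j) ^+ 2] after completing [C] to a
   uniform sample of size [n].  The Lipschitz bound then controls the difference
   by third absolute moments.  In the zero bias terminology this is
   [`|F - Phi|_1 <= 2 E `|W^* - W|] for an explicit coupling. *)

(** The weight [s] is only measurable, so [H] is written as a superposition over [t], with weight
    [s t], of the classical solutions of Stein's equation for half-lines. The integrals that enter
    it need not be differentiable where [s] jumps; only their combination is. Its regularity is
    therefore proved by two-point estimates with quadratic error, each an L1 bound on a kernel in
    [t] that is split at [x] and [y]. The Lipschitz constant 2 appears because the kernel of [H']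
    has integral zero: its increment from [x] to [y] weighs as much between the two points as
    outside them, and one of these weights is at most [y - x].

    The coupling is never realized by random variables. Only its law matters, and this law is a
    family of double counts of subsets, with all denominators cleared. The factor
    [n (N - n) / (N (N - 1))] of the theorem is the share of samples that contain a given label and
    omit another one. *)

Section calculus.
Context {R : realType}.
Implicit Types (f df : R -> R) (x y : R).

Lemma is_derive_continuous f x (a : R) : is_derive x 1 f a -> {for x, continuous f}.
Proof. by case=> + _ => /derivable1_diffP/differentiable_continuous. Qed.

Lemma derive_ge0_nondecreasing f df : (forall x, is_derive x 1 f (df x)) ->
  forall x y, (forall z, x <= z <= y -> 0 <= df z) -> x <= y -> f x <= f y.
Proof.
move=> fdf x y df0 xy; have [eqxy|xy'] := eqVneq x y; first by rewrite eqxy.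
have ltxy : x < y by rewrite lt_neqAle xy'.
have cf : {within `[x, y], continuous f}.
  by apply: continuous_subspaceT => z; apply: is_derive_continuous (fdf z).
have [z zxy E] := MVT ltxy (fun z _ => fdf z) cf.
rewrite -subr_ge0 E mulr_ge0 ?subr_ge0//; apply: df0.
by move: zxy; rewrite in_itv/= => /andP[/ltW -> /ltW ->].
Qed.

(** The source of the signs of the normal tail quantities: [phi - Phi], [Phi_prim] and
    [phi * d2mills] all vanish at minus infinity. *)
Lemma derive_ge0_cvgNy0_ge0 f df y : (forall x, is_derive x 1 f (df x)) ->
  (forall z, z <= y -> 0 <= df z) -> f x @[x --> -oo] --> (0 : R) -> 0 <= f y.
Proof.
move=> fdf df0 f0; apply: (cvgr_to_le f0).
near=> x; apply: (derive_ge0_nondecreasing fdf) => [z /andP[_]|].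
  exact: df0.
by near: x; apply: nbhs_ninfty_le; rewrite num_real.
Unshelve. all: end_near. Qed.

Lemma cvgNy0_le_inv f C : (forall x, x <= -1 -> `|f x| <= C / - x) ->
  f x @[x --> -oo] --> (0 : R).
Proof.
move=> fC; apply/cvgr0Pnorm_le => e e0; near=> x.
have x1 : x <= -1 by near: x; apply: nbhs_ninfty_le; rewrite num_real.
apply: le_trans (fC _ x1) _; rewrite ler_pdivrMr; last lra.
suff : x <= - (C / e) by rewrite lerNr ler_pdivrMr// => ?; nra.
by near: x; apply: nbhs_ninfty_le; rewrite num_real.
Unshelve. all: end_near. Qed.

(** The form in which differentiability is available for [stein_sol], where no regularity of the
    weight can be used. *)
Lemma is_derive_quad f C a x :
  (forall y, `|f y - f x - (y - x) * a| <= C * (y - x) ^+ 2) ->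
  is_derive x 1 f a.
Proof.
move=> fC; suff H : h^-1 *: (f (h *: 1 + x) - f x) @[h --> 0^'] --> a.
  by split; [apply/cvg_ex; exists a|apply/cvg_lim].
have C0 : 0 <= C.
  have := fC (x + 1); rewrite (_ : x + 1 - x = 1); last by ring.
  by rewrite expr1n mulr1; exact: le_trans.
apply/cvgrPdist_le => e e0; near=> h.
have h0 : h != 0 by near: h; exact: nbhs_dnbhs_neq.
rewrite /GRing.scale/= mulr1.
have -> : a - h^-1 * (f (h + x) - f x) = - h^-1 * (f (h + x) - f x - (h + x - x) * a).
  by field.
rewrite normrM normrN normfV mulrC ler_pdivrMr ?normr_gt0//.
apply: le_trans (fC _) _; rewrite addrK -[h ^+ 2]ger0_norm ?sqr_ge0// normrX expr2 mulrA.
rewrite ler_wpM2r//.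
have : `|h| <= e / (C + 1) by near: h; apply: dnbhs0_le; rewrite divr_gt0// ltr_pwDr.
rewrite ler_pdivlMr ?ltr_pwDr// => ?; have := normr_ge0 h; nra.
Unshelve. all: end_near. Qed.

Lemma quad_nonincreasing f df C :
  (forall x y, `|f y - f x - (y - x) * df x| <= C * (y - x) ^+ 2) ->
  (forall x, df x <= 0) -> forall x y, x <= y -> f y <= f x.
Proof.
move=> fC df0 x y xy; rewrite -lerN2.
have dNf (z : R) : is_derive z 1 (fun z => - f z) (- df z).
  exact: is_deriveN (is_derive_quad (fC z)).
by apply: (derive_ge0_nondecreasing dNf) => // z _; rewrite oppr_ge0.
Qed.

(** An antiderivative of [2 * |x|], so that a Lipschitz bound with constant 2 integrates to an
    increment of [sqn]. *)
Definition sqn x : R := x * `|x|.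

Lemma sqn0 : sqn 0 = 0. Proof. by rewrite /sqn mul0r. Qed.

Lemma sqnN x : sqn (- x) = - sqn x.
Proof. by rewrite /sqn normrN mulNr. Qed.

Lemma norm_sqn x : `|sqn x| = `|x| ^+ 2.
Proof. by rewrite /sqn normrM normr_id expr2. Qed.

Lemma sqn_quad x y :
  `|sqn y - sqn x - (y - x) * (2 * `|x|)| <= 2 * (y - x) ^+ 2.
Proof.
rewrite /sqn; have := sqr_ge0 (y - x); have := sqr_ge0 x; have := sqr_ge0 y.
have [x0|x0] := ger0P x; have [y0|y0] := ger0P y;
  rewrite ler_norml => ? ? ?; apply/andP; split; nra.
Qed.

Lemma sqn_mono x y : x <= y -> sqn x <= sqn y.
Proof.
rewrite /sqn; have [x0|x0] := ger0P x; have [y0|y0] := ger0P y => xy; nra.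
Qed.

(** The function [sqn (u - z) - sqn u - 2 * u * |z|] of [u] has derivative
    [2 * (|u - z| - |u| - |z|)], which is at most 0. The estimate detaches [z], so that sums over
    three labels factor into moments. *)
Lemma sqn_dist_le x y z :
  `|sqn (x - z) - sqn (y - z)| <= `|sqn x - sqn y| + 2 * `|x - y| * `|z|.
Proof.
wlog yx : x y / y <= x => [W|].
  have [/W//|/ltW/W] := leP y x.
  by rewrite distrC [`|sqn y - _|]distrC [`|y - x|]distrC.
rewrite [`|x - y|]ger0_norm ?subr_ge0//.
rewrite (ger0_norm (_ : 0 <= sqn (x - z) - _)); last first.
  by rewrite subr_ge0 sqn_mono// lerD2r.
rewrite (ger0_norm (_ : 0 <= sqn x - _)); last by rewrite subr_ge0 sqn_mono.
have Q := sqn_quad.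
suff : sqn (x - z) - sqn x - x * (2 * `|z|) <= sqn (y - z) - sqn y - y * (2 * `|z|) by lra.
apply: (@quad_nonincreasing (fun u => sqn (u - z) - sqn u - u * (2 * `|z|))
  (fun u => 2 * `|u - z| - 2 * `|u| - 2 * `|z|) 4) => // [u v|u]; last first.
  by have := ler_normB u z; lra.
have := Q u v; have := Q (u - z) (v - z).
rewrite (_ : v - z - (u - z) = v - u); last by ring.
by rewrite !ler_norml => /andP[? ?] /andP[? ?]; apply/andP; split; lra.
Qed.

End calculus.

(** * The standard normal distribution *)

Section standard_normal.
Context {R : realType}.
Implicit Types x y t w : R.

Definition phi x : R := normal_pdf 0 1 x.
Definition Phi x : R := fine (std_normal_cdf x).

Lemma phiE x : phi x = normal_peak 1 * expR (- x ^+ 2 / 2).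
Proof.
by rewrite /phi normal_pdfE ?oner_eq0// /normal_fun subr0 expr1n.
Qed.

Lemma phi_gt0 x : 0 < phi x.
Proof. by rewrite phiE mulr_gt0 ?expR_gt0// normal_peak_gt0 ?oner_eq0. Qed.

Lemma phi_neq0 x : phi x != 0. Proof. by rewrite gt_eqF ?phi_gt0. Qed.

Lemma phiN x : phi (- x) = phi x. Proof. by rewrite !phiE sqrrN. Qed.

Global Instance is_derive_phi x : is_derive x 1 phi (- x * phi x).
Proof.
have -> : phi = fun x => normal_peak 1 * expR (- x ^+ 2 / 2).
  by apply/funext => y; rewrite phiE.
by apply: is_derive_eq; rewrite /GRing.scale/=; field.
Qed.

Lemma std_normal_cdfE x : std_normal_cdf x = (Phi x)%:E.
Proof. by rewrite fineK// fin_num_measure. Qed.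

Lemma Phi_ge0 x : 0 <= Phi x. Proof. by rewrite fine_ge0. Qed.

Lemma continuous_phi : continuous phi.
Proof. by apply: continuous_normal_pdf; rewrite oner_eq0. Qed.

Global Instance is_derive_Phi x : is_derive x 1 Phi (phi x).
Proof.
have iphi : lebesgue_measure.-integrable [set` Interval -oo%O (BRight (x + 1))] (EFin \o phi).
  by apply: integrableS (integrable_normal_pdf 0 1).
have xx1 : x < x + 1 by rewrite ltrDl.
have [|d1 d2] := continuous_FTC1 xx1 iphi _ (@continuous_phi x).
  by rewrite ltNyr.
by split; [exact: d1|rewrite -derive1E; exact: d2].
Qed.

(** The identity as a random variable under the normal law, through which the limits of a [cdf] pass
    to [Phi]. *)
Let idTR : measurableTypeR R -> R := idfun.

#[local] HB.instance Definition _ :=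
  @isMeasurableFun.Build _ _ _ _ idTR (@measurable_id _ _ setT).

Let normal01 : probability (measurableTypeR R) R := normal_prob 0 1.

Let cdfE : cdf (idTR : {RV normal01 >-> R}) = EFin \o Phi.
Proof. by apply/funext => x; rewrite /= -std_normal_cdfE. Qed.

Lemma cvg_PhiNy0 : Phi x @[x --> -oo] --> (0 : R).
Proof.
have := cvg_cdfNy0 (idTR : {RV normal01 >-> R}).
by rewrite cdfE => /fine_cvgP[].
Qed.

Lemma cvg_Phiy1 : Phi x @[x --> +oo] --> (1 : R).
Proof.
have := cvg_cdfy1 (idTR : {RV normal01 >-> R}).
by rewrite cdfE => /fine_cvgP[].
Qed.

Lemma PhiN x : Phi (- x) = 1 - Phi x.
Proof.
apply/eqP; rewrite eq_sym subr_eq; apply/eqP; pose S := Phi \o -%R + Phi.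
have dS y : is_derive y 1 S 0.
  by apply: is_derive_eq; rewrite phiN; ring.
have S1 : S y @[y --> +oo] --> (1 : R).
  by rewrite -[1]add0r; apply: cvgD cvg_Phiy1;
    exact: ((cvgNy_compNP Phi (nbhs (0 : R))).1 cvg_PhiNy0).
have SE y : S y = S x by exact: is_derive_0_is_cst.
have Sx : S y @[y --> +oo] --> S x.
  by under eq_fun do rewrite SE; exact: cvg_cst.
exact: (cvg_unique _ S1 Sx).
Qed.

End standard_normal.

(** * The Mills ratio, its derivatives and the integrated normal tail *)

Section mills.
Context {R : realType}.
Implicit Types x y t w : R.

(** Squaring [1 + x ^+ 2 / 4 <= expR (x ^+ 2 / 4)] bounds [expR (x ^+ 2 / 2)] below by
    [x ^+ 4 / 16]. The fourth power exceeds by one the cubic majorant of [cvgNy0_le_phi], which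
    leaves a decay of order [1 / - x]. *)
Lemma phi_quartic x : x ^+ 4 * phi x <= 16 * normal_peak 1.
Proof.
rewrite phiE mulrCA mulrC ler_wpM2r ?normal_peak_ge0//.
rewrite mulNr expRN -ler_pdivlMr ?invr_gt0 ?expR_gt0// invrK.
have -> : x ^+ 2 / 2 = x ^+ 2 / 4 + x ^+ 2 / 4 by field.
rewrite expRD; have := expR_ge1Dx (x ^+ 2 / 4).
by have := sqr_ge0 x; nra.
Qed.

Lemma cvgNy0_le_phi (f : R -> R) M :
  (forall x, x <= -1 -> `|f x| <= M * ((- x) ^+ 3 * phi x)) ->
  f x @[x --> -oo] --> (0 : R).
Proof.
move=> fM; apply: (@cvgNy0_le_inv _ _ (`|M| * (16 * normal_peak 1))) => x x1.
apply: le_trans (fM _ x1) _; rewrite ler_pdivlMr; last lra.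
apply: (@le_trans _ _ (`|M| * ((- x) ^+ 3 * phi x) * - x)).
  apply: ler_wpM2r; first lra.
  apply: ler_wpM2r (ler_norm M); apply: mulr_ge0 (ltW (phi_gt0 x)).
  by apply: exprn_ge0; lra.
rewrite -mulrA ler_wpM2l//; apply: le_trans (phi_quartic x).
by rewrite le_eqVlt; apply/orP; left; apply/eqP; ring.
Qed.

Lemma Phi_le_phi x : x <= -1 -> Phi x <= phi x.
Proof.
move=> x1; rewrite -subr_ge0.
apply: (@derive_ge0_cvgNy0_ge0 _ (phi - Phi) (fun x => (- x - 1) * phi x)) => [y|z zx|].
- by apply: is_derive_eq; ring.
- by apply: mulr_ge0 (ltW (phi_gt0 z)); lra.
- rewrite -[0]subr0; apply: cvgB cvg_PhiNy0.
  apply: (@cvgNy0_le_phi _ 1) => y y1; have := phi_gt0 y => p0.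
  rewrite (gtr0_norm p0) mul1r ler_peMl//; first exact: ltW.
  by apply: exprn_ege1; lra.
Qed.

(** The integral of [Phi] up to [x], that is, the mean of the positive part of [x - Z] for a
    standard normal [Z]. *)
Definition Phi_prim x : R := phi x + x * Phi x.

Global Instance is_derive_Phi_prim x : is_derive x 1 Phi_prim (Phi x).
Proof. by apply: is_derive_eq; rewrite /GRing.scale/=; ring. Qed.

Lemma cvg_Phi_primNy0 : Phi_prim x @[x --> -oo] --> (0 : R).
Proof.
apply: (@cvgNy0_le_phi _ 2) => x x1; have := phi_gt0 x => p0.
have := Phi_le_phi x1; have := Phi_ge0 x => P0 Pp.
have x3 : - x <= (- x) ^+ 3 by apply: ler_eXnr => //; lra.
rewrite /Phi_prim; apply: le_trans (ler_normD _ _) _.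
rewrite (gtr0_norm p0) normrM (ger0_norm P0) ler0_norm; last lra.
have : phi x <= - x * phi x.
  by apply: ler_peMl; [exact: ltW|lra].
have : - x * Phi x <= - x * phi x by apply: ler_wpM2l => //; lra.
have : - x * phi x <= (- x) ^+ 3 * phi x by rewrite ler_wpM2r// ltW.
lra.
Qed.

Lemma Phi_prim_ge0 x : 0 <= Phi_prim x.
Proof.
apply: (derive_ge0_cvgNy0_ge0 (@is_derive_Phi_prim)) => [z _|].
  exact: Phi_ge0.
exact: cvg_Phi_primNy0.
Qed.

Lemma Phi_prim_nondecreasing x y : x <= y -> Phi_prim x <= Phi_prim y.
Proof.
by apply: (derive_ge0_nondecreasing (@is_derive_Phi_prim)) => z _; exact: Phi_ge0.
Qed.

Lemma Phi_primN x : Phi_prim (- x) = Phi_prim x - x.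
Proof. by rewrite /Phi_prim phiN PhiN; ring. Qed.

(** The classical Mills ratio [(1 - Phi z) / phi z] taken at [z = - x]. *)
Definition mills x : R := Phi x / phi x.

Lemma PhiE x : Phi x = phi x * mills x.
Proof. by rewrite mulrC divfK ?phi_neq0. Qed.

Definition dmills x : R := 1 + x * mills x.

Lemma Phi_primE x : Phi_prim x = phi x * dmills x.
Proof. by rewrite /Phi_prim /dmills PhiE; ring. Qed.

Lemma dmills_ge0 x : 0 <= dmills x.
Proof. by rewrite -(pmulr_rge0 _ (phi_gt0 x)) -Phi_primE Phi_prim_ge0. Qed.

Global Instance is_derive_mills x : is_derive x 1 mills (dmills x).
Proof.
have dV : is_derive x 1 (fun x => (phi x)^-1) (- (phi x) ^- 2 *: (- x * phi x)).
  by apply: is_deriveV; rewrite phi_neq0.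
have -> : mills = Phi * (fun x => (phi x)^-1) by [].
apply: is_derive_eq; rewrite /GRing.scale/= /dmills /mills.
by field; rewrite phi_neq0.
Qed.

Definition d2mills x : R := (1 + x ^+ 2) * mills x + x.

Global Instance is_derive_dmills x : is_derive x 1 dmills (d2mills x).
Proof. by apply: is_derive_eq; rewrite /GRing.scale/= /dmills /d2mills; ring. Qed.

(** Multiplying by [phi] clears the denominator of [mills]; the product has derivative
    [2 * Phi_prim] and tends to 0 at minus infinity. *)
Lemma d2mills_ge0 x : 0 <= d2mills x.
Proof.
rewrite -(pmulr_rge0 _ (phi_gt0 x)).
have -> : phi x * d2mills x = (1 + x ^+ 2) * Phi x + x * phi x.
  by rewrite PhiE /d2mills; ring.
apply: (@derive_ge0_cvgNy0_ge0 _ (fun x => (1 + x ^+ 2) * Phi x + x * phi x)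
  (fun x => 2 * Phi_prim x)) => [y|z _|].
- by apply: is_derive_eq; rewrite /GRing.scale/= /Phi_prim; ring.
- by rewrite mulr_ge0 ?Phi_prim_ge0.
- apply: (@cvgNy0_le_phi _ 3) => y y1; have := phi_gt0 y => p0.
  have := Phi_le_phi y1; have := Phi_ge0 y => P0 Pp.
  have y1' : 1 <= - y by lra.
  have y2 : 1 <= y ^+ 2 by rewrite -sqrrN; exact: exprn_ege1.
  have y23 : y ^+ 2 <= (- y) ^+ 3 by rewrite -sqrrN; apply: ler_weXn2l.
  have y13 : - y <= (- y) ^+ 3 by exact: ler_eXnr.
  apply: le_trans (ler_normD _ _) _.
  rewrite !normrM (ger0_norm P0) (gtr0_norm p0) ger0_norm; last lra.
  rewrite ler0_norm; last lra.
  have : (1 + y ^+ 2) * Phi y <= (2 * (- y) ^+ 3) * phi y.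
    by apply: ler_pM => //; lra.
  have : - y * phi y <= (- y) ^+ 3 * phi y by rewrite ler_wpM2r// ltW.
  lra.
Qed.

Lemma dmills_nondecreasing x y : x <= y -> dmills x <= dmills y.
Proof.
by apply: (derive_ge0_nondecreasing (@is_derive_dmills)) => z _; exact: d2mills_ge0.
Qed.

Lemma mills_incr_ge x y : x <= y -> (y - x) * dmills x <= mills y - mills x.
Proof.
move=> xy; have dg (z : R) : is_derive z 1 (fun z => mills z - z * dmills x) (dmills z - dmills x).
  by apply: is_derive_eq; rewrite /GRing.scale/=; ring.
suff : mills x - x * dmills x <= mills y - y * dmills x by lra.
apply: (derive_ge0_nondecreasing dg _ xy) => z /andP[xz _].
by rewrite subr_ge0 dmills_nondecreasing.
Qed.

Lemma mills_incr_le x y : x <= y -> mills y - mills x <= (y - x) * dmills y.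
Proof.
move=> xy.
have dg (z : R) : is_derive z 1 (fun z => z * dmills y - mills z) (dmills y - dmills z).
  by apply: is_derive_eq; rewrite /GRing.scale/=; ring.
suff : x * dmills y - mills x <= y * dmills y - mills y by lra.
apply: (derive_ge0_nondecreasing dg _ xy) => z /andP[_ zy].
by rewrite subr_ge0 dmills_nondecreasing.
Qed.

Lemma mills_swap x : mills x * Phi (- x) = mills (- x) * Phi x.
Proof. by rewrite /mills phiN; field; rewrite phi_neq0. Qed.

(** This is [phi x] times the Wronskian of [mills x] and [mills (- x)], two solutions of
    [u'' = x * u' + u]. Both terms are nonnegative, hence each is at most 1. *)
Lemma dmills_convex x : dmills x * Phi (- x) + dmills (- x) * Phi x = 1.
Proof. by rewrite /dmills /mills phiN PhiN; field; rewrite phi_neq0. Qed.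

(** This is [phi x] times the Wronskian of [dmills x] and [dmills (- x)], two solutions of
    [u'' = x * u' + 2 * u]. *)
Lemma mills_wronskian x :
  d2mills x * Phi_prim (- x) + d2mills (- x) * Phi_prim x = 1.
Proof.
rewrite /d2mills /mills /Phi_prim !phiN PhiN; field.
by rewrite phi_neq0.
Qed.

(* With [x] fixed, the derivative in [y] of the left-hand side is
   [1 - (Phi_prim y - Phi_prim x) * d2mills (- y) - (dmills y - dmills x) * Phi (- y)]. *)
Lemma stein_kernel_variation x y : x <= y ->
  (dmills y - dmills x) * Phi_prim (- y)
  + Phi_prim x * (dmills (- x) - dmills (- y)) <= y - x.
Proof.
move=> xy.
pose g z := z - (dmills z - dmills x) * Phi_prim (- z)
  - Phi_prim x * (dmills (- x) - dmills (- z)).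
have dN (z : R) : is_derive z 1 (-%R : R -> R) (-1) by exact: is_deriveNid.
have dg (z : R) : is_derive z 1 g ((Phi_prim z - Phi_prim x) * d2mills (- z)
    + (dmills z - dmills x) * Phi (- z)).
  rewrite /g; apply: is_derive_eq; rewrite /GRing.scale/=.
  have := mills_wronskian z; nra.
suff : g x <= g y by rewrite /g; lra.
apply: (derive_ge0_nondecreasing dg _ xy) => z /andP[xz _].
apply: addr_ge0; apply: mulr_ge0; rewrite ?d2mills_ge0 ?Phi_ge0// subr_ge0.
  exact: Phi_prim_nondecreasing.
exact: dmills_nondecreasing.
Qed.

End mills.

(** * Stein's equation *)

Section stein.
Context {R : realType}.
Implicit Types x y t w : R.
Local Notation mu := (@lebesgue_measure R).

(** For fixed [t], the classical solution of Stein's equation for the half-line up to [t] is [mills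
    w * Phi_right w t + mills (- w) * Phi_left w t]. Each of the two kernels is integrable in
    [t]. *)
Definition Phi_left w t : R := if t < w then Phi t else 0.
Definition Phi_right w t : R := if t < w then 0 else Phi (- t).

Lemma continuous_Phi : continuous (@Phi R).
Proof. by move=> x; exact: is_derive_continuous (is_derive_Phi x). Qed.

Let Phi_leftE w : Phi_left w = Phi \_ `]-oo, w[.
Proof.
by apply/funext => t; rewrite patchE/= mem_setE in_itv/= /Phi_left.
Qed.

Let Phi_rightE w : Phi_right w = (Phi \o -%R) \_ `[w, +oo[.
Proof.
apply/funext => t; rewrite patchE/= mem_setE in_itv/= andbT /Phi_right.
by case: ltP.
Qed.

Let continuous_PhiN : continuous (@Phi R \o -%R).
Proof. by move=> x; apply: continuous_comp; [exact: opp_continuous|exact: continuous_Phi]. Qed.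

Let integral_PhiN w : (\int[mu]_(t in `[w, +oo[) (Phi (- t))%:E = (Phi_prim (- w))%:E)%E.
Proof.
have dF t : is_derive t 1 (fun t => - Phi_prim (- t)) (Phi (- t)).
  have dN : is_derive t 1 (-%R : R -> R) (-1) by exact: is_deriveNid.
  by apply: is_derive_eq; rewrite /GRing.scale/=; ring.
rewrite (@ge0_continuous_FTC2y _ (Phi \o -%R) (fun t => - Phi_prim (- t)) w 0).
- by rewrite sub0e EFinN oppeK.
- by move=> t _; exact: Phi_ge0.
- by apply: continuous_subspaceT => t; exact: continuous_PhiN.
- rewrite -oppr0; apply: cvgN.
  exact: ((cvgNy_compNP Phi_prim (nbhs (0 : R))).1 cvg_Phi_primNy0).
- by move=> t _; exact: (@ex_derive _ _ _ _ _ _ _ (dF t)).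
- by apply: cvg_at_right_filter; exact: is_derive_continuous (dF w).
- by move=> t _; rewrite derive1E (@derive_val _ _ _ _ _ _ _ (dF t)).
Qed.

Let integral_Phi w : (\int[mu]_(t in `]-oo, w[) (Phi t)%:E = (Phi_prim w)%:E)%E.
Proof.
rewrite integral_itv_bndo_bndc; last first.
  apply/measurable_EFinP; apply: measurable_funTS.
  exact: continuous_measurable_fun continuous_Phi.
have -> : w = - (- w) by rewrite opprK.
rewrite ge0_integration_by_substitutionNy ?opprK//.
- by rewrite -[w]opprK -integral_PhiN opprK.
- by apply: continuous_subspaceT => t; exact: continuous_Phi.
- by move=> t _; exact: Phi_ge0.
Qed.

Let ge0_integrable_fin (D : set R) (f : R -> R) c : measurable D ->
  continuous f -> (forall t, 0 <= f t) ->
  (\int[mu]_(t in D) (f t)%:E = c%:E)%E -> mu.-integrable setT (EFin \o (f \_ D)).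
Proof.
move=> mD cf f0 fc; rewrite -restrict_EFin; apply: (integrable_mkcond (mu := mu) (EFin \o f) mD).1.
apply/integrableP; split.
  by apply/measurable_EFinP/measurable_funTS; exact: continuous_measurable_fun.
by under eq_integral do rewrite gee0_abs ?lee_fin//; rewrite fc ltry.
Qed.

Lemma integrable_Phi_left w : mu.-integrable setT (EFin \o Phi_left w).
Proof.
rewrite Phi_leftE.
apply: (ge0_integrable_fin _ continuous_Phi _ (integral_Phi w)) => // t.
exact: Phi_ge0.
Qed.

Lemma integrable_Phi_right w : mu.-integrable setT (EFin \o Phi_right w).
Proof.
rewrite Phi_rightE.
apply: (ge0_integrable_fin _ continuous_PhiN _ (integral_PhiN w)) => // t.
exact: Phi_ge0.
Qed.

Lemma Rintegral_Phi_left w : \int[mu]_t Phi_left w t = Phi_prim w.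
Proof. by rewrite Phi_leftE -Rintegral_mkcond /Rintegral integral_Phi. Qed.

Lemma Rintegral_Phi_right w : \int[mu]_t Phi_right w t = Phi_prim (- w).
Proof. by rewrite Phi_rightE -Rintegral_mkcond /Rintegral integral_PhiN. Qed.


Lemma Phi_right_sub_left w t : Phi_right w t - Phi_left w t = (w <= t)%R%:R - Phi t.
Proof.
by rewrite /Phi_right /Phi_left; case: ltP => _; rewrite ?PhiN/=; ring.
Qed.

Let integrableZl_EFin (f : R -> R) k : mu.-integrable setT (EFin \o f) ->
  mu.-integrable setT (EFin \o (fun t => k * f t)).
Proof. by move=> fi; exact: (integrableZl measurableT k fi). Qed.

Let integrableD_EFin (f g : R -> R) : mu.-integrable setT (EFin \o f) ->
  mu.-integrable setT (EFin \o g) ->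
  mu.-integrable setT (EFin \o (fun t => f t + g t)).
Proof. by move=> fi gi; exact: (integrableD measurableT fi gi). Qed.

Let integrable_comb (f g h k : R -> R) (a b c d : R) :
  mu.-integrable setT (EFin \o f) -> mu.-integrable setT (EFin \o g) ->
  mu.-integrable setT (EFin \o h) -> mu.-integrable setT (EFin \o k) ->
  mu.-integrable setT
    (EFin \o (fun t => a * f t + b * g t + (c * h t + d * k t))).
Proof.
move=> fi gi hi ki.
by apply: integrableD_EFin; apply: integrableD_EFin; exact: integrableZl_EFin.
Qed.

Let Rintegral_comb (f g h k : R -> R) (a b c d : R) :
  mu.-integrable setT (EFin \o f) -> mu.-integrable setT (EFin \o g) ->
  mu.-integrable setT (EFin \o h) -> mu.-integrable setT (EFin \o k) ->
  \int[mu]_t (a * f t + b * g t + (c * h t + d * k t)) =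
  a * (\int[mu]_t f t) + b * (\int[mu]_t g t)
  + (c * (\int[mu]_t h t) + d * (\int[mu]_t k t)).
Proof.
move=> fi gi hi ki.
rewrite RintegralD//; [|exact: integrableD_EFin (integrableZl_EFin _ fi) (integrableZl_EFin _ gi)
  |exact: integrableD_EFin (integrableZl_EFin _ hi) (integrableZl_EFin _ ki)].
rewrite RintegralD//; [|exact: integrableZl_EFin..].
rewrite RintegralD//; [|exact: integrableZl_EFin..].
by rewrite !RintegralZl.
Qed.

Section sign_weight.
Variable s : R -> R.
Hypothesis ms : measurable_fun setT s.
Hypothesis s1 : forall t, `|s t| <= 1.

Definition wPhi_left w := \int[mu]_t (s t * Phi_left w t).
Definition wPhi_right w := \int[mu]_t (s t * Phi_right w t).

Lemma integrable_weight (f : R -> R) : mu.-integrable setT (EFin \o f) ->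
  mu.-integrable setT (EFin \o (fun t => s t * f t)).
Proof.
move=> fi; apply: (le_integrable _ _ _ fi) => //.
  apply/measurable_EFinP; apply: measurable_funM => //.
  by apply/measurable_EFinP; exact: (measurable_int mu fi).
move=> t _; rewrite lee_fin normrM.
by rewrite ler_piMl.
Qed.

(** Since [s] is bounded by 1, a pointwise bound on a kernel survives integration against [s], and
    the bound itself integrates to values of [Phi_prim]. The estimates for [stein_der] and
    [stein_sol] thus reduce to inequalities on three ranges of [t]. *)
Lemma wPhi_comb_le c1 c2 c3 c4 e1 e2 e3 e4 x y :
  (forall t, `|c1 * Phi_left x t + c2 * Phi_left y t
               + (c3 * Phi_right x t + c4 * Phi_right y t)| <=
     e1 * Phi_left x t + e2 * Phi_left y t
     + (e3 * Phi_right x t + e4 * Phi_right y t)) ->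
  `|c1 * wPhi_left x + c2 * wPhi_left y
    + (c3 * wPhi_right x + c4 * wPhi_right y)| <=
  e1 * Phi_prim x + e2 * Phi_prim y
  + (e3 * Phi_prim (- x) + e4 * Phi_prim (- y)).
Proof.
move=> ce; have iL := integrable_Phi_left; have iR := integrable_Phi_right.
have isL w := integrable_weight (iL w); have isR w := integrable_weight (iR w).
rewrite -(Rintegral_Phi_right x) -(Rintegral_Phi_right y).
rewrite -(Rintegral_Phi_left x) -(Rintegral_Phi_left y) -!Rintegral_comb//.
have ic := integrable_comb c1 c2 c3 c4 (isL x) (isL y) (isR x) (isR y).
apply: le_trans (le_normr_Rintegral _ ic) _ => //.
apply: le_Rintegral => //.
- exact/(integrable_abse ic).
- exact: integrable_comb.
- move=> t _; apply: le_trans (ce t).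
  have -> : c1 * (s t * Phi_left x t) + c2 * (s t * Phi_left y t) +
     (c3 * (s t * Phi_right x t) + c4 * (s t * Phi_right y t)) =
     s t * (c1 * Phi_left x t + c2 * Phi_left y t
               + (c3 * Phi_right x t + c4 * Phi_right y t)) by ring.
  by rewrite normrM ler_piMl.
Qed.

End sign_weight.

End stein.

(** * Regularity of the solution of Stein's equation *)

Section stein_equation.
Context {R : realType}.
Implicit Types x y t w : R.
Variable s : R -> R.
Hypothesis ms : measurable_fun setT s.
Hypothesis s1 : forall t, `|s t| <= 1.

(* The solution of Stein's equation [H' w - w * H w = \int s t (1_(w <= t) - Phi t) dt]. *)
Definition stein_sol w : R :=
  mills w * wPhi_right s w + mills (- w) * wPhi_left s w.

Definition stein_der w : R :=
  dmills w * wPhi_right s w - dmills (- w) * wPhi_left s w.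

Lemma stein_equation w :
  stein_der w - w * stein_sol w = wPhi_right s w - wPhi_left s w.
Proof. by rewrite /stein_der /stein_sol /dmills; ring. Qed.

Lemma Phi_left_right_split x y t : x <= y ->
  [\/ [/\ Phi_left x t = Phi t, Phi_left y t = Phi t, Phi_right x t = 0,
          Phi_right y t = 0 & t < x],
      [/\ Phi_left x t = 0, Phi_left y t = Phi t, Phi_right x t = Phi (- t),
          Phi_right y t = 0 & x <= t <= y] |
      [/\ Phi_left x t = 0, Phi_left y t = 0, Phi_right x t = Phi (- t),
          Phi_right y t = Phi (- t) & y <= t]].
Proof.
move=> xy; rewrite /Phi_left /Phi_right.
have [tx|xt] := ltP t x; first by constructor 1; rewrite (lt_le_trans tx xy).
have [ty|yt] := ltP t y; last by constructor 3.
by constructor 2; split=> //; apply/andP; split=> //; exact: ltW.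
Qed.

Lemma stein_der_lip_le x y : x <= y ->
  `|stein_der y - stein_der x| <= 2 * (y - x).
Proof.
move=> xy; set A := @dmills R; set p := @Phi_prim R.
have Axy : A x <= A y by exact: dmills_nondecreasing.
have Bxy : A (- y) <= A (- x) by apply: dmills_nondecreasing; rewrite lerN2.
have [Ax0 By0] : 0 <= A x /\ 0 <= A (- y) by split; exact: dmills_ge0.
(* The last four coefficients are solved from the absolute value of the kernel increment: the two
   left ones add up below [x], the two right ones add up above [y], and in between only those of
   [Phi_left y] and [Phi_right x] remain. *)
have H := @wPhi_comb_le _ s ms s1 (A (- x)) (- A (- y)) (- A x) (A y)
  (A (- x) - A (- y) - A (- y)) (A (- y)) (A x) (A y - A x - A x) x y.
have -> : stein_der y - stein_der x =
  A (- x) * wPhi_left s x + - A (- y) * wPhi_left s y +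
  (- A x * wPhi_right s x + A y * wPhi_right s y).
  by rewrite /stein_der -/A; ring.
apply: le_trans (H _) _.
  move=> t; have P0 := Phi_ge0 t; have Q0 := Phi_ge0 (- t).
  case: (Phi_left_right_split t xy) => -[-> -> -> -> _].
  - rewrite [X in `|X|](_ : _ = (A (- x) - A (- y)) * Phi t); last by ring.
    rewrite ger0_norm ?mulr_ge0 ?subr_ge0//.
    by rewrite le_eqVlt; apply/orP; left; apply/eqP; ring.
  - rewrite [X in `|X|](_ : _ = - (A (- y) * Phi t + A x * Phi (- t))); last by ring.
    rewrite normrN ger0_norm ?addr_ge0 ?mulr_ge0//.
    by rewrite le_eqVlt; apply/orP; left; apply/eqP; ring.
  - rewrite [X in `|X|](_ : _ = (A y - A x) * Phi (- t)); last by ring.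
    rewrite ger0_norm ?mulr_ge0 ?subr_ge0//.
    by rewrite le_eqVlt; apply/orP; left; apply/eqP; ring.
(* This says that the kernel of [stein_der] has integral zero. It makes the integrated bound exactly
   twice the left-hand side of [stein_kernel_variation]. *)
have E z : A (- z) * p z = A z * p (- z) by rewrite /A /p !Phi_primE phiN; ring.
have := stein_kernel_variation xy; rewrite -/A -/p.
move: (E x) (E y); clear; lra.
Qed.

Lemma stein_der_lip x y : `|stein_der y - stein_der x| <= 2 * `|y - x|.
Proof.
have [xy|/ltW yx] := leP x y.
  by rewrite [`|y - x|]ger0_norm ?subr_ge0// stein_der_lip_le.
rewrite distrC [`|y - x|]distrC [`|x - y|]ger0_norm ?subr_ge0//.
exact: stein_der_lip_le.
Qed.

(** Subtracting the common value of [mills_swap] at [t] from both products leaves two nonnegative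
    increments. By convexity of [mills] and [dmills_convex] they are at most [t - x] and [y - t]. *)
Lemma mills_cross_le x y t : x <= t <= y ->
  `|mills (- y) * Phi t - mills x * Phi (- t)| <= y - x.
Proof.
case/andP=> xt ty; have P0 := Phi_ge0 t; have Q0 := Phi_ge0 (- t).
have Nty : - y <= - t by rewrite lerN2.
have sw := mills_swap t; have cv := dmills_convex t.
have [tx0 yt0] : 0 <= t - x /\ 0 <= y - t by rewrite !subr_ge0.
have [AtQ0 AtP0] : 0 <= dmills t * Phi (- t) /\ 0 <= dmills (- t) * Phi t.
  by split; rewrite mulr_ge0// dmills_ge0.
have h1 : (t - x) * (dmills t * Phi (- t)) <= t - x.
  by rewrite ler_piMr// -cv lerDl.
have h2 : (y - t) * (dmills (- t) * Phi t) <= y - t.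
  by rewrite ler_piMr// -cv lerDr.
have h3 : 0 <= (mills (- t) - mills (- y)) * Phi t.
  rewrite mulr_ge0//; apply: le_trans (mills_incr_ge Nty).
  by rewrite mulr_ge0 ?dmills_ge0// subr_ge0.
have h4 : 0 <= (mills t - mills x) * Phi (- t).
  by rewrite mulr_ge0//; apply: le_trans (mills_incr_ge xt); rewrite mulr_ge0 ?dmills_ge0.
have h5 : (mills t - mills x) * Phi (- t) <= (t - x) * dmills t * Phi (- t).
  by rewrite ler_wpM2r// mills_incr_le.
have h6 : (mills (- t) - mills (- y)) * Phi t <= (- t - - y) * dmills (- t) * Phi t.
  by rewrite ler_wpM2r// mills_incr_le.
rewrite [X in `|X|](_ : _ = (mills t - mills x) * Phi (- t)
  - (mills (- t) - mills (- y)) * Phi t); last by rewrite !mulrBl sw; ring.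
rewrite (_ : (- t - - y) * dmills (- t) * Phi t
  = (y - t) * (dmills (- t) * Phi t)) in h6; last by ring.
rewrite -mulrA in h5.
move: h1 h2 h3 h4 h5 h6 tx0 yt0; clear; move=> *.
by rewrite ler_norml; apply/andP; split; lra.
Qed.

Lemma stein_sol_quad_le x y : x <= y ->
  `|stein_sol y - stein_sol x - (y - x) * stein_der x| <= 4 * (y - x) ^+ 2.
Proof.
move=> xy; set A := @dmills R; set p := @Phi_prim R; set m := @mills R.
have Nyx : - y <= - x by rewrite lerN2.
have yx0 : 0 <= y - x by rewrite subr_ge0.
have Axy : A x <= A y by exact: dmills_nondecreasing.
have Bxy : A (- y) <= A (- x) by exact: dmills_nondecreasing.
have [Ax0 By0] : 0 <= A x /\ 0 <= A (- y) by split; exact: dmills_ge0.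
pose d := y - x; have d0 : 0 <= d := yx0.
(* The majorant of [stein_der_lip_le] times [d]. The terms with 2 cancel outside [[x, y]]; inside
   they absorb the bound [d] of [mills_cross_le]. *)
have H := @wPhi_comb_le _ s ms s1
  (- m (- x) + d * A (- x)) (m (- y)) (- m x - d * A x) (m y)
  (d * (A (- x) - A (- y) - A (- y) - 2)) (d * (A (- y) + 2))
  (d * (A x + 2)) (d * (A y - A x - A x - 2)) x y.
have -> : stein_sol y - stein_sol x - (y - x) * stein_der x =
  (- m (- x) + d * A (- x)) * wPhi_left s x + m (- y) * wPhi_left s y +
  ((- m x - d * A x) * wPhi_right s x + m y * wPhi_right s y).
  rewrite /stein_sol /stein_der -/A -/m /d; ring.
have m1 := mills_incr_ge xy; have m2 := mills_incr_le xy.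
have m3 := mills_incr_ge Nyx; have m4 := mills_incr_le Nyx.
have dN : - x - - y = d by rewrite /d; ring.
rewrite -/A -/m -?/d ?dN in m1 m2 m3 m4.
apply: le_trans (H _) _.
  move=> t; have P0 := Phi_ge0 t; have Q0 := Phi_ge0 (- t).
  case: (Phi_left_right_split t xy) => -[-> -> -> -> ht].
  - rewrite [X in `|X|](_ : _ = (m (- y) - m (- x) + d * A (- x)) * Phi t); last by ring.
    rewrite ger0_norm; last by rewrite mulr_ge0//; move: m4; clear; lra.
    rewrite [leRHS](_ : _ = (d * (A (- x) - A (- y))) * Phi t); last by ring.
    by rewrite ler_wpM2r//; move: m3; clear; lra.
  - have hd := mills_cross_le ht.
    rewrite [X in `|X|](_ : _ = m (- y) * Phi t - m x * Phi (- t)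
      - d * A x * Phi (- t)); last by ring.
    apply: le_trans (ler_normB _ _) _.
    rewrite [X in _ + X]ger0_norm; last by rewrite !mulr_ge0.
    rewrite [leRHS](_ : _ = d * A (- y) * Phi t + d * A x * Phi (- t)
      + 2 * d * (Phi t + Phi (- t))); last by ring.
    rewrite (_ : Phi t + Phi (- t) = 1) ?mulr1; last by rewrite PhiN; ring.
    apply: (@le_trans _ _ (d + d * A x * Phi (- t))); first by rewrite lerD2r.
    have : 0 <= d * A (- y) * Phi t by rewrite !mulr_ge0.
    move: yx0; rewrite -/d; clear; lra.
  - rewrite [X in `|X|](_ : _ = (m y - m x - d * A x) * Phi (- t)); last by ring.
    rewrite ger0_norm; last by rewrite mulr_ge0//; move: m1; clear; lra.
    rewrite [leRHS](_ : _ = (d * (A y - A x)) * Phi (- t)); last by ring.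
    by rewrite ler_wpM2r//; move: m2; clear; lra.
have E z : A (- z) * p z = A z * p (- z) by rewrite /A /p !Phi_primE phiN; ring.
have PN z : p (- z) = p z - z := Phi_primN z.
have := stein_kernel_variation xy; rewrite -/A -/p => kv.
have ex := E x; have ey := E y; have px := PN x; have py := PN y.
(* The first [2 * d] comes from the kernel variation, the second from [Phi t + Phi (- t) = 1]
   integrated over [[x, y]]. *)
apply: (@le_trans _ _ (d * (2 * d + 2 * d))); last first.
  by rewrite le_eqVlt; apply/orP; left; apply/eqP; rewrite /d; ring.
rewrite -!mulrA -!mulrDr ler_wpM2l//.
have pxy : p y - p x + (p (- x) - p (- y)) = d by rewrite /d px py; ring.
move: kv ex ey pxy; rewrite -/d; clear; lra.
Qed.

(** For [y < x] the derivative has to be moved from [y] to [x], at a cost of [2 * (y - x) ^+ 2];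
    hence 6 = 4 + 2. Only the quadratic order matters later. *)
Lemma stein_sol_quad x y :
  `|stein_sol y - stein_sol x - (y - x) * stein_der x| <= 6 * (y - x) ^+ 2.
Proof.
have [xy|/ltW yx] := leP x y.
  by apply: le_trans (stein_sol_quad_le xy) _; rewrite ler_wpM2r ?sqr_ge0//; lra.
have -> : stein_sol y - stein_sol x - (y - x) * stein_der x =
  - (stein_sol x - stein_sol y - (x - y) * stein_der y)
  + (y - x) * (stein_der y - stein_der x) by ring.
apply: le_trans (ler_normD _ _) _; rewrite normrN normrM.
have := stein_sol_quad_le yx; have := stein_der_lip x y.
have : `|y - x| * `|y - x| = (y - x) ^+ 2 by rewrite -normrM -expr2 ger0_norm ?sqr_ge0.
have : (x - y) ^+ 2 = (y - x) ^+ 2 by ring.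
have := normr_ge0 (y - x); nra.
Qed.

(* The right-hand side is the absolute value of [\int_x^y 2 * `|u - w| du], the
   bound given by the Lipschitz constant 2 of [stein_der]. *)
Lemma stein_sol_taylor w x y :
  `|stein_sol y - stein_sol x - (y - x) * stein_der w| <=
  `|sqn (y - w) - sqn (x - w)|.
Proof.
pose q z := sqn (z - w).
have qquad u z : `|q z - q u - (z - u) * (2 * `|u - w|)| <= 2 * (z - u) ^+ 2.
  by have := sqn_quad (u - w) (z - w); rewrite (_ : z - w - (u - w) = z - u)//; ring.
have lip z := stein_der_lip w z.
have P u z : u <= z -> `|stein_sol z - stein_sol u - (z - u) * stein_der w| <= q z - q u.
  move=> uz; rewrite ler_norml; apply/andP; split.
  - have := @quad_nonincreasing _ (fun z => - stein_sol z + z * stein_der w - q z)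
      (fun z => - stein_der z + stein_der w - 2 * `|z - w|) 8 _ _ u z uz.
    move=> H; suff : - stein_sol z + z * stein_der w - q z <= - stein_sol u + u * stein_der w - q u by lra.
    apply: H => [v v'|v]; last by have := lip v; rewrite ler_norml => /andP[]; lra.
    have := stein_sol_quad v v'; have := qquad v v'.
    by rewrite !ler_norml => /andP[? ?] /andP[? ?]; apply/andP; split; lra.
  - have := @quad_nonincreasing _ (fun z => stein_sol z - z * stein_der w - q z)
      (fun z => stein_der z - stein_der w - 2 * `|z - w|) 8 _ _ u z uz.
    move=> H; suff : stein_sol z - z * stein_der w - q z <= stein_sol u - u * stein_der w - q u by lra.
    apply: H => [v v'|v]; last by have := lip v; rewrite ler_norml => /andP[]; lra.
    have := stein_sol_quad v v'; have := qquad v v'.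
    by rewrite !ler_norml => /andP[? ?] /andP[? ?]; apply/andP; split; lra.
rewrite -/(q y) -/(q x).
have [xy|/ltW yx] := leP x y.
  by apply: le_trans (P _ _ xy) _; exact: ler_norm.
rewrite [leRHS]distrC; apply: le_trans (ler_norm _).
rewrite [leLHS](_ : _ = `|stein_sol x - stein_sol y - (x - y) * stein_der w|).
  exact: P.
by rewrite -normrN; congr `|_|; ring.
Qed.

End stein_equation.

Section stein_L1.
Context {R : realType}.
Local Notation mu := (@lebesgue_measure R).

(* Stein's equation for the weight [s = sgn (F - Phi)], so that
   [\int s (F - Phi) = \int `|F - Phi|]. *)
Lemma stein_L1 (I : finType) (P : pred I) (w : I -> R) (c : R) : 0 <= c ->
  exists H K : R -> R,
    (forall u x y, `|H y - H x - (y - x) * K u| <=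
       `|sqn (y - u) - sqn (x - u)|) /\
    (\int[mu]_t (c * `|\sum_(i | P i) ((w i <= t)%R%:R - Phi t)|)%:E
       = (c * \sum_(i | P i) (K (w i) - w i * H (w i)))%:E)%E.
Proof.
move=> c0; pose D t : R := \sum_(i | P i) ((w i <= t)%R%:R - Phi t).
pose g i t : R := Phi_right (w i) t - Phi_left (w i) t.
have DE t : D t = \sum_(i | P i) g i t.
  by apply: eq_bigr => i _; rewrite /g Phi_right_sub_left.
have ig i : mu.-integrable setT (EFin \o g i).
  exact: integrableB (integrable_Phi_right (w i)) (integrable_Phi_left (w i)).
have mD : measurable_fun setT D.
  rewrite (_ : D = fun t => \sum_(i <- [seq i <- index_enum I | P i]) g i t).
    apply: measurable_sum => i.
    by apply/measurable_EFinP; exact: (measurable_int mu (ig i)).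
  by apply/funext => t; rewrite big_filter DE.
pose s t : R := if D t < 0 then -1 else 1.
have ms : measurable_fun setT s.
  apply: measurable_fun_ifT => //.
  exact: (measurable_fun_ltr mD (measurable_cst (0 : R))).
have s1 t : `|s t| <= 1 by rewrite /s; case: ifP; rewrite ?normrN normr1.
have sD t : s t * D t = `|D t|.
  rewrite /s; case: (ltrP (D t) 0) => D0; first by rewrite mulN1r ltr0_norm.
  by rewrite mul1r ger0_norm.
exists (stein_sol s), (stein_der s); split; first exact: stein_sol_taylor.
have isg i : mu.-integrable setT (EFin \o (fun t => s t * g i t)).
  exact: integrable_weight.
under eq_integral do rewrite EFinM.
rewrite ge0_integralZl_EFin//; last first.
  by apply/measurable_EFinP; exact: measurableT_comp.
rewrite EFinM; congr (_ * _)%E.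
transitivity (\int[mu]_t (\sum_(i | P i) (s t * g i t)%:E))%E.
  by apply: eq_integral => t _; rewrite sumEFin -mulr_sumr -DE sD.
rewrite integral_sum//.
rewrite -sumEFin; apply: eq_bigr => i _; rewrite stein_equation.
rewrite -RintegralB//; [|exact: integrable_weight (integrable_Phi_right _)
  |exact: integrable_weight (integrable_Phi_left _)].
rewrite /Rintegral fineK; last first.
  have -> : (fun t => (s t * Phi_right (w i) t - s t * Phi_left (w i) t)%:E) =
      EFin \o (fun t => s t * g i t).
    by apply/funext => t /=; rewrite /g mulrBr.
  exact: (integrable_fin_num measurableT (isg i)).
by apply: eq_integral => t _; rewrite /g mulrBr.
Qed.

End stein_L1.

(** * Sums over subsets of fixed size *)

Section subset_sums.
Context {R : realType} {T : finType}.
Implicit Types (B C : {set T}) (i j r : T).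

Lemma sum_subsets_setU1 (k : nat) i (P : pred {set T}) (g : {set T} -> R) :
  \sum_(B : {set T} | [&& #|B| == k.+1, i \in B & P (B :\ i)]) g B =
  \sum_(C : {set T} | [&& #|C| == k, i \notin C & P C]) g (i |: C).
Proof.
rewrite (reindex_onto (fun C => i |: C) (fun B => B :\ i)) => [|B /and3P[_ iB _]].
  apply: eq_bigl => C; rewrite setU11/=.
  have [iC|iC] := boolP (i \in C).
    rewrite andbF; apply/negbTE/negP => /andP[_ /eqP E].
    by move: iC; rewrite -E setD11.
  by rewrite cardsU1 iC/= add1n eqSS setU1K// eqxx andbT.
by rewrite finset.setD1K.
Qed.

Definition pair_free (k : nat) i j : pred {set T} :=
  fun C => [&& #|C| == k, i \notin C & j \notin C].

Lemma pair_freeC k i j : pair_free k i j =1 pair_free k j i.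
Proof. by move=> C; rewrite /pair_free [_ && (j \notin C)]andbC. Qed.

Lemma sum_subsets_pair (k : nat) i j (g : {set T} -> R) : i != j ->
  \sum_(B : {set T} | (#|B| == k.+1) && ((i \in B) && (j \notin B))) g B =
  \sum_(C : {set T} | pair_free k i j C) g (i |: C).
Proof.
move=> ij; rewrite -(sum_subsets_setU1 _ _ (fun C => j \notin C)).
by apply: eq_bigl => B; rewrite !inE negb_and negbK [j == i]eq_sym (negbTE ij).
Qed.

(** Double counting: each [B] arises from [k.+1] pairs, one for every [r] in [B], with
    [C = B :\ r]. *)
Lemma sum_subsets_avoid (k : nat) i j (g : {set T} -> R) :
  k.+1%:R * \sum_(B : {set T} | (#|B| == k.+1) && ((i \notin B) && (j \notin B))) g B =
  \sum_(C : {set T} | pair_free k i j C)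
    \sum_(r | [&& r \notin C, r != i & r != j]) g (r |: C).
Proof.
transitivity (\sum_(B : {set T} | (#|B| == k.+1) && ((i \notin B) && (j \notin B)))
    \sum_(r | r \in B) g B).
  rewrite mulr_sumr; apply: eq_bigr => B /andP[/eqP Bk _].
  by rewrite sumr_const Bk mulr_natl.
rewrite (exchange_big_dep (fun r => (r != i) && (r != j)))/=; last first.
  move=> B r /and3P[_ iB jB] rB.
  by apply/andP; split; [apply: contraNneq iB|apply: contraNneq jB] => <-.
rewrite [RHS](exchange_big_dep (fun r => (r != i) && (r != j)))/=; last first.
  by move=> C r _ /and3P[_ -> ->].
apply: eq_bigr => r /andP[ri rj].
rewrite [LHS](eq_bigl (fun B : {set T} => [&& #|B| == k.+1, r \in B &
    (i \notin B :\ r) && (j \notin B :\ r)])); last first.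
  by move=> B; rewrite !inE [i == r]eq_sym [j == r]eq_sym ri rj/= -andbA [X in _ && X]andbC.
rewrite (sum_subsets_setU1 _ _ (fun C => (i \notin C) && (j \notin C))).
apply: eq_bigl => C; rewrite /pair_free ri rj !andbT.
by case: (i \in C); case: (j \in C); case: (r \in C); rewrite ?andbF ?andbT.
Qed.

(** Double counting: each [B] arises once for every [r] outside it, from the [C] that has [r] in
    place of [i] and [j]. *)
Lemma sum_subsets_contain (k : nat) i j (g : {set T} -> R) : i != j ->
  (#|T|%:R - k.+2%:R) * \sum_(B : {set T} | (#|B| == k.+2) && ((i \in B) && (j \in B))) g B =
  \sum_(C : {set T} | pair_free k.+1 i j C) \sum_(r in C) g (i |: (j |: C :\ r)).
Proof.
move=> ij; have ji : j != i by rewrite eq_sym.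
transitivity (\sum_(B : {set T} | (#|B| == k.+2) && ((i \in B) && (j \in B)))
    \sum_(r | r \notin B) g B).
  rewrite mulr_sumr; apply: eq_bigr => B /andP[/eqP Bk _].
  rewrite (eq_bigl (fun r => r \in ~: B)) => [|r]; last by rewrite inE.
  by rewrite sumr_const cardsCs finset.setCK -Bk -[RHS]mulr_natl natrB ?max_card.
rewrite (exchange_big_dep (fun r => (r != i) && (r != j)))/=; last first.
  move=> B r /and3P[_ iB jB] rB.
  by apply/andP; split; apply: contraNneq rB => ->.
rewrite [RHS](exchange_big_dep (fun r => (r != i) && (r != j)))/=; last first.
  move=> C r /and3P[_ iC jC] rC.
  by apply/andP; split; [apply: contraNneq iC|apply: contraNneq jC] => <-.
apply: eq_bigr => r /andP[ri rj].
rewrite [LHS](eq_bigl (fun B : {set T} => [&& #|B| == k.+2, i \in B &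
    (j \in B :\ i) && (r \notin B :\ i)])); last first.
  by move=> B; rewrite !inE ji ri/= -!andbA.
rewrite (sum_subsets_setU1 _ _ (fun C => (j \in C) && (r \notin C))).
rewrite [LHS](eq_bigl (fun C : {set T} => [&& #|C| == k.+1, j \in C &
    (i \notin C :\ j) && (r \notin C :\ j)])); last first.
  move=> C; rewrite !inE ij rj/=.
  by case: (i \in C); case: (j \in C); case: (r \in C); rewrite ?andbF ?andbT.
rewrite (sum_subsets_setU1 _ _ (fun C => (i \notin C) && (r \notin C))).
rewrite [RHS](eq_bigl (fun C : {set T} => [&& #|C| == k.+1, r \in C &
    (i \notin C :\ r) && (j \notin C :\ r)])); last first.
  move=> C; rewrite /pair_free !inE [i == r]eq_sym [j == r]eq_sym ri rj/=.
  by case: (i \in C); case: (j \in C); case: (r \in C); rewrite ?andbF ?andbT.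
rewrite (sum_subsets_setU1 _ _ (fun C => (i \notin C) && (j \notin C))).
rewrite [RHS](eq_bigl (fun C : {set T} => [&& #|C| == k, j \notin C,
    i \notin C & r \notin C])); last first.
  by move=> C; case: (i \in C); case: (j \in C); case: (r \in C); rewrite ?andbF ?andbT.
by apply: eq_bigr => C /and4P[_ _ _ rC]; rewrite setU1K.
Qed.

(* The zero bias coupling in averaged form: starting from a uniform [C], the
   four sums are the ways to reach a uniform sample of size [k.+2], according to
   its intersection with [{i, j}]. *)
Lemma sum_subsets_coupling (k : nat) i j (g : {set T} -> R) : i != j ->
  let n := k.+2%:R in let m := #|T|%:R - n in
  n * m * \sum_(B : {set T} | #|B| == k.+2) g B =
  \sum_(C : {set T} | pair_free k.+1 i j C)
    (n * m * (g (i |: C) + g (j |: C))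
     + (m * (\sum_(r | [&& r \notin C, r != i & r != j]) g (r |: C))
     + n * (\sum_(r in C) g (i |: (j |: C :\ r))))).
Proof.
move=> ij n m; have ji : j != i by rewrite eq_sym.
rewrite !big_split/= -!mulr_sumr -sum_subsets_avoid -sum_subsets_contain//.
rewrite big_split/= -sum_subsets_pair// (eq_bigl _ _ (pair_freeC k.+1 i j)).
rewrite -sum_subsets_pair//.
rewrite (bigID (fun B : {set T} => i \in B))/=.
rewrite (bigID (fun B : {set T} => j \in B))/=.
rewrite [X in _ + X](bigID (fun B : {set T} => j \in B))/=.
have A (P Q : pred {set T}) :
  \sum_(B : {set T} | (#|B| == k.+2) && P B && Q B) g B =
  \sum_(B : {set T} | (#|B| == k.+2) && (P B && Q B)) g B.
  by apply: eq_bigl => B; rewrite andbA.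
rewrite !A.
have -> : \sum_(B : {set T} | [&& #|B| == k.+2, j \in B & i \notin B]) g B =
    \sum_(B : {set T} | [&& #|B| == k.+2, i \notin B & j \in B]) g B.
  by apply: eq_bigl => B; rewrite [(j \in B) && _]andbC.
rewrite -/n -/m; ring.
Qed.

Section zero_sum.
Variable b : T -> R.
Hypothesis b0 : \sum_i b i = 0.

Definition subset_sum B : R := \sum_(x in B) b x.

Lemma subset_sumU1 i B : i \notin B -> subset_sum (i |: B) = subset_sum B + b i.
Proof. by move=> iB; rewrite /subset_sum big_setU1//= addrC. Qed.

Lemma subset_sumD1 i B : i \in B -> subset_sum (B :\ i) = subset_sum B - b i.
Proof. by move=> iB; rewrite /subset_sum [in RHS](big_setD1 i)//= addrAC subrr add0r. Qed.

(** The linear regression property of the swap: as [b] has sum zero, the expected change under a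
    random exchange of an inner and an outer label is proportional to the subset sum. *)
Lemma subset_sum_swaps B :
  #|T|%:R * subset_sum B = \sum_(i in B) \sum_(j | j \notin B) (b i - b j).
Proof.
have bC : \sum_(j | j \notin B) b j = - subset_sum B.
  apply/eqP; rewrite -addr_eq0 addrC; apply/eqP.
  by rewrite -[RHS]b0 [RHS](bigID (mem B)).
transitivity (\sum_(i in B) ((#|T|%:R - #|B|%:R) * b i + subset_sum B)).
  rewrite big_split/= -mulr_sumr sumr_const -/(subset_sum B) -[_ *+ _]mulr_natl; ring.
apply: eq_bigr => i _; rewrite big_split/= sumrN bC opprK; congr (_ + _).
rewrite (eq_bigl (fun r => r \in ~: B)) => [|r]; last by rewrite inE.
by rewrite sumr_const [in RHS]cardsCs finset.setCK -[RHS]mulr_natl natrB ?max_card.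
Qed.

Lemma sum_subsets_exchange (k : nat) (H : R -> R) :
  2 * #|T|%:R * \sum_(B : {set T} | #|B| == k.+1) subset_sum B * H (subset_sum B) =
  \sum_i \sum_j \sum_(C : {set T} | pair_free k i j C)
    (b i - b j) * (H (subset_sum C + b i) - H (subset_sum C + b j)).
Proof.
have E : #|T|%:R * (\sum_(B : {set T} | #|B| == k.+1) subset_sum B * H (subset_sum B)) =
  \sum_i \sum_j \sum_(C : {set T} | pair_free k i j C)
    (b i - b j) * H (subset_sum C + b i).
  rewrite mulr_sumr.
  transitivity (\sum_(B : {set T} | #|B| == k.+1) \sum_(i in B)
      \sum_(j | j \notin B) (b i - b j) * H (subset_sum B)).
    apply: eq_bigr => B _; rewrite mulrA subset_sum_swaps mulr_suml.
    by apply: eq_bigr => i _; rewrite mulr_suml.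
  rewrite (exchange_big_dep xpredT)//=; apply: eq_bigr => i _.
  rewrite (exchange_big_dep xpredT)//=; apply: eq_bigr => j _.
  have [->|ij] := eqVneq i j.
    by rewrite subrr !big1// => [C|B] _; rewrite mul0r.
  transitivity (\sum_(B : {set T} | (#|B| == k.+1) && ((i \in B) && (j \notin B)))
      (b i - b j) * H (subset_sum B)); first by apply: eq_bigl => B; rewrite andbA.
  rewrite sum_subsets_pair//; apply: eq_bigr => C /and3P[_ iC _].
  by rewrite subset_sumU1.
(* The same sum with the names [i] and [j] exchanged. Adding it to [E] turns [H] into a difference,
   which explains the factor 2. *)
have E' : #|T|%:R * (\sum_(B : {set T} | #|B| == k.+1) subset_sum B * H (subset_sum B)) =
  \sum_i \sum_j \sum_(C : {set T} | pair_free k i j C)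
    (b j - b i) * H (subset_sum C + b j).
  rewrite E exchange_big/=; apply: eq_bigr => i _; apply: eq_bigr => j _.
  exact/eq_bigl/pair_freeC.
rewrite -mulrA mulr_natl mulr2n [in X in _ + X]E' E -!big_split/=.
apply: eq_bigr => i _; rewrite -big_split/=; apply: eq_bigr => j _.
by rewrite -big_split/=; apply: eq_bigr => C _; ring.
Qed.

End zero_sum.

End subset_sums.

(** * Third moments *)

Section moments.
Context {R : realType} {T : finType}.
Variable b : T -> R.
Implicit Types i j r : T.
Local Notation N := (#|T|%:R : R).

Lemma sum_pair (f g : T -> R) :
  \sum_i \sum_j (f i - f j) * (g i - g j) =
  2 * N * (\sum_i f i * g i) - 2 * (\sum_i f i) * (\sum_i g i).
Proof.
transitivity (\sum_i (N * (f i * g i) - f i * (\sum_j g j)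
   - g i * (\sum_j f j) + \sum_j f j * g j)).
  apply: eq_bigr => i _; rewrite mulr_sumr mulr_sumr mulr_natl -sumr_const.
  rewrite -!sumrB -big_split/=; apply: eq_bigr => j _; ring.
rewrite !big_split/= !sumrN -!mulr_suml -mulr_sumr sumr_const -[_ *+ _]mulr_natl.
ring.
Qed.

(** The values [b i ^+ 2] and [|b i|] are ordered alike, so every product in [sum_pair] is
    nonnegative. *)
Lemma chebyshev_moments :
  (\sum_i b i ^+ 2) * (\sum_i `|b i|) <= N * \sum_i `|b i| ^+ 3.
Proof.
have := sum_pair (fun i => b i ^+ 2) (fun i => `|b i|).
have -> : \sum_i b i ^+ 2 * `|b i| = \sum_i `|b i| ^+ 3.
  by apply: eq_bigr => i _; rewrite -[b i ^+ 2]real_normK ?num_real// -exprSr.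
have : 0 <= \sum_i \sum_j (b i ^+ 2 - b j ^+ 2) * (`|b i| - `|b j|).
  apply: sumr_ge0 => i _; apply: sumr_ge0 => j _.
  rewrite -[b i ^+ 2]real_normK ?num_real// -[b j ^+ 2]real_normK ?num_real//.
  rewrite subr_sqr mulrAC -expr2 mulr_ge0 ?sqr_ge0 ?addr_ge0//.
lra.
Qed.

Hypothesis b0 : \sum_i b i = 0.

Lemma sum_dist2 : \sum_i \sum_j (b i - b j) ^+ 2 = 2 * N * \sum_i b i ^+ 2.
Proof.
transitivity (\sum_i \sum_j (b i - b j) * (b i - b j)).
  by apply: eq_bigr => i _; apply: eq_bigr => j _; rewrite expr2.
by rewrite sum_pair b0 mulr0 subr0; congr (_ * _).
Qed.

(** One factor [|b i - b j|] is replaced by [|b i| + |b j|]. Expanding the square gives twice [N]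
    times the third moment plus a mixed product, which [chebyshev_moments] bounds by the same
    quantity. *)
Lemma sum_dist3 :
  \sum_i \sum_j `|b i - b j| ^+ 3 <= 4 * N * \sum_i `|b i| ^+ 3.
Proof.
apply: (@le_trans _ _ (\sum_i \sum_j (b i - b j) ^+ 2 * (`|b i| + `|b j|))).
  apply: ler_sum => i _; apply: ler_sum => j _.
  rewrite exprSr real_normK ?num_real// ler_wpM2l ?sqr_ge0//.
  exact: ler_normB.
have -> : \sum_i \sum_j (b i - b j) ^+ 2 * (`|b i| + `|b j|) =
    2 * (\sum_i \sum_j (b i - b j) ^+ 2 * `|b i|).
  rewrite mulr_natl mulr2n [in X in _ = _ + X]exchange_big -big_split/=.
  apply: eq_bigr => i _; rewrite -big_split/=; apply: eq_bigr => j _.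
  by rewrite [(b j - b i) ^+ 2](_ : _ = (b i - b j) ^+ 2); ring.
have -> : \sum_i \sum_j (b i - b j) ^+ 2 * `|b i| =
    N * (\sum_i `|b i| ^+ 3) + (\sum_i b i ^+ 2) * (\sum_i `|b i|).
  transitivity (\sum_i (N * `|b i| ^+ 3 + (\sum_j b j ^+ 2) * `|b i|
      - 2 * (b i * `|b i|) * \sum_j b j)).
    apply: eq_bigr => i _; rewrite mulr_natl -sumr_const mulr_suml mulr_sumr.
    rewrite -big_split -sumrB/=; apply: eq_bigr => j _.
    have -> : `|b i| ^+ 3 = b i ^+ 2 * `|b i| by rewrite exprSr real_normK ?num_real.
    by ring.
  rewrite b0 big_split/= big_split/= [X in _ + X]big1 ?addr0 => [|i _].
    by rewrite -!mulr_sumr.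
  by rewrite mulr0 oppr0.
have := chebyshev_moments; lra.
Qed.

(** The Taylor error for the pair [i], [j] when the reference point exceeds the sum over [C] by
    [b r]. *)
Definition spread i j r : R :=
  `|b i - b j| * `|sqn (b i - b r) - sqn (b j - b r)|.

Lemma spread_diagl i j : spread i j i = `|b i - b j| ^+ 3.
Proof.
by rewrite /spread subrr sqn0 sub0r normrN norm_sqn [`|b j - b i|]distrC exprS.
Qed.

Lemma spread_diagr i j : spread i j j = `|b i - b j| ^+ 3.
Proof.
by rewrite /spread subrr sqn0 subr0 norm_sqn exprS.
Qed.

(** By [sqn_dist_le] the reference label separates: 2 of the 6 comes from the part free of [r], and
    4 from the product of second and first moments, again by [chebyshev_moments]. *)
Lemma sum_spread :
  \sum_i \sum_j \sum_r spread i j r <= 6 * N ^+ 2 * \sum_i `|b i| ^+ 3.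
Proof.
have -> : 6 * N ^+ 2 * \sum_i `|b i| ^+ 3 = N * (2 * N * \sum_i `|b i| ^+ 3)
  + 4 * N * (N * \sum_i `|b i| ^+ 3) by ring.
have S1 : \sum_i \sum_j (b i - b j) * (sqn (b i) - sqn (b j)) =
    2 * N * \sum_i `|b i| ^+ 3.
  rewrite sum_pair b0 mulr0 mul0r subr0; congr (_ * _); apply: eq_bigr => i _.
  by rewrite /sqn mulrA -expr2 [RHS]exprSr real_normK ?num_real.
apply: (@le_trans _ _ (N * (\sum_i \sum_j (b i - b j) * (sqn (b i) - sqn (b j)))
  + 2 * (\sum_i \sum_j (b i - b j) ^+ 2) * (\sum_r `|b r|))); last first.
  rewrite S1 sum_dist2 lerD2l.
  have := chebyshev_moments; have : 0 <= N by []. nra.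
have [Z ZE] : exists Z, Z = \sum_r `|b r| by eexists.
rewrite -ZE [2 * _ * Z]mulrAC.
rewrite !mulr_sumr -big_split/=; apply: ler_sum => i _.
rewrite !mulr_sumr -big_split/=; apply: ler_sum => j _.
rewrite [2 * Z * _]mulrAC ZE mulr_natl -sumr_const mulr_sumr -big_split/=.
apply: ler_sum => r _.
rewrite /spread; apply: le_trans (ler_wpM2l _ (sqn_dist_le _ _ _)) _ => //.
rewrite mulrDr mulrA [X in _ + X](_ : _ = 2 * (b i - b j) ^+ 2 * `|b r|); last first.
  by rewrite -[(b i - b j) ^+ 2]real_normK ?num_real//; ring.
rewrite lerD2r.
wlog ij : i j / b j <= b i => [W|].
  have [/W//|/ltW/W] := leP (b j) (b i).
  by rewrite distrC [`|sqn (b j) - _|]distrC -[X in _ <= X]mulrNN !opprB.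
by rewrite !ger0_norm ?subr_ge0// sqn_mono.
Qed.

End moments.

(** * The exchangeable pair *)

Section sample_bound.
Context {R : realType} {T : finType}.
Variable b : T -> R.
Hypothesis b0 : \sum_i b i = 0.
Variable k : nat.
Implicit Types (i j r : T) (B C : {set T}).
Local Notation N := (#|T|%:R : R).
Local Notation n := (k.+2%:R : R).
Local Notation m := (N - n).
Local Notation w := (subset_sum b).

Lemma card_pair_free_out i j C : i != j -> pair_free k.+1 i j C ->
  (\sum_(r | [&& r \notin C, r != i & r != j]) 1 : R) = N - k.+3%:R.
Proof.
move=> ij /and3P[/eqP Ck iC jC].
rewrite (eq_bigl (fun r => r \in ~: (i |: (j |: C)))) => [|r]; last first.
  by rewrite !inE !negb_or andbC -andbA.
rewrite sumr_const cardsCs finset.setCK natrB ?max_card//.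
by rewrite !cardsU1 !inE negb_or ij iC jC Ck.
Qed.

Lemma card_pair_free i j : i != j ->
  #|pair_free k.+1 i j| = 'C(#|T| - 2, k.+1).
Proof.
move=> ij; have <- : #|~: [set i; j]| = (#|T| - 2)%N.
  by rewrite cardsCs finset.setCK cards2 ij.
rewrite -cards_draws; apply: eq_card => C; rewrite !inE [LHS]unfold_in /pair_free andbC.
by rewrite finset.subsetC finset.subUset !finset.sub1set !inE.
Qed.

Lemma card_pair_free_avoid i j r : i != j -> r != i -> r != j ->
  #|[pred C | pair_free k.+1 i j C && (r \notin C)]| = 'C(#|T| - 3, k.+1).
Proof.
move=> ij ri rj; have <- : #|~: (r |: [set i; j])| = (#|T| - 3)%N.
  by rewrite cardsCs finset.setCK cardsU1 cards2 ij !inE negb_or ri rj.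
rewrite -cards_draws; apply: eq_card => C; rewrite !inE /= /pair_free.
rewrite finset.subsetC !finset.subUset !finset.sub1set !inE.
by case: (_ == _) (i \in C) (j \in C) (r \in C) => - [] [] [].
Qed.

Variables H K : R -> R.
Hypothesis taylor : forall u x y,
  `|H y - H x - (y - x) * K u| <= `|sqn (y - u) - sqn (x - u)|.

Let e i j C u := (b i - b j) *
  ((b i - b j) * K u - (H (w C + b i) - H (w C + b j))).

Lemma taylor_defect_le i j C u :
  `|e i j C u| <= `|b i - b j| * `|sqn (w C + b i - u) - sqn (w C + b j - u)|.
Proof.
rewrite /e normrM ler_wpM2l// distrC.
have := taylor u (w C + b j) (w C + b i).
by rewrite (_ : w C + b i - (w C + b j) = b i - b j)//; ring.
Qed.

(** For each [C] the weights of [sum_subsets_coupling] add up to [2 n m + m (m - 1) + n (n - 1) = N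
    (N - 1)], so the second sum can be distributed over the same completions of [C]. *)
Lemma exchange_defect i j : i != j ->
  (b i - b j) ^+ 2 * (n * m * (\sum_(B : {set T} | #|B| == k.+2) K (w B)))
  - N * (N - 1) * (\sum_(C : {set T} | pair_free k.+1 i j C)
      (b i - b j) * (H (w C + b i) - H (w C + b j))) =
  \sum_(C : {set T} | pair_free k.+1 i j C)
   (n * m * (e i j C (w (i |: C)) + e i j C (w (j |: C)))
    + (m * (\sum_(r | [&& r \notin C, r != i & r != j]) e i j C (w (r |: C)))
    + n * (\sum_(r in C) e i j C (w (i |: (j |: C :\ r)))))).
Proof.
move=> ij; have /= -> := @sum_subsets_coupling R T k i j (fun B => K (w B)) ij.
rewrite !mulr_sumr -sumrB.
apply: eq_bigr => C Cij; have c1 := card_pair_free_out ij Cij.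
have c2 : (\sum_(r in C) 1 : R) = k.+1%:R.
  by rewrite sumr_const; case/and3P: Cij => /eqP ->.
set d := b i - b j; set h := H (w C + b i) - H (w C + b j).
have E (P : pred T) (f : T -> R) : \sum_(r | P r) e i j C (f r) =
    d ^+ 2 * (\sum_(r | P r) K (f r)) - d * h * (\sum_(r | P r) 1).
  rewrite !mulr_sumr -sumrB; apply: eq_bigr => r _.
  by rewrite /e -/d -/h; ring.
rewrite !E c1 c2 /e -/d -/h.
rewrite (_ : k.+3%:R = n + 1); last by rewrite -natr1.
rewrite (_ : k.+1%:R = n - 1); last by rewrite -[in RHS]natr1 addrK.
by ring.
Qed.


Local Notation beta := (\sum_i `|b i| ^+ 3).
Local Notation M := ('C(#|T| - 2, k.+1)%:R : R).

Hypothesis kT : (k.+4 <= #|T|)%N.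

Let m_ge1 : 1 <= m.
Proof. by rewrite lerBrDr addrC natr1 ler_nat; move: kT; lia. Qed.

(** Both sides count the triples of a sample of size [k.+2], a label in it and a label outside
    it. *)
Lemma card_pair_free_natmul : N * (N - 1) * M = n * m * 'C(#|T|, k.+2)%:R.
Proof.
have [N' NE] : exists N', #|T| = N'.+2 by exists (#|T| - 2)%N; move: kT; lia.
have kN' : (k <= N')%N by move: kT; rewrite NE; lia.
have /(congr1 (fun x => x%:R : R)) := mul_bin_diag N'.+2 k.+1.
have /(congr1 (fun x => x%:R : R)) := mul_bin_down N'.+1 k.+1.
rewrite NE !subSS subn0/= !natrM natrB//.
rewrite -[N'.+2%:R]natr1 -[k.+2%:R]natr1 -[N'.+1%:R]natr1 -[k.+1%:R]natr1 => h1 h2.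
rewrite (_ : N'%:R + 1 + 1 - 1 = N'%:R + 1); last by ring.
rewrite -mulrA h1 mulrCA h2; ring.
Qed.

(** For fixed [i] and [j], both sides count the sets [C] together with a further label outside
    [C]. *)
Lemma card_pair_free_avoid_natmul :
  (N - 2) * 'C(#|T| - 3, k.+1)%:R = (m - 1) * M.
Proof.
have [N' NE] : exists N', #|T| = N'.+3 by exists (#|T| - 3)%N; move: kT; lia.
have kN' : (k <= N')%N by move: kT; rewrite NE; lia.
have /(congr1 (fun x => x%:R : R)) := mul_bin_down N'.+1 k.+1.
rewrite NE !subSS !subn0/= !natrM natrB//.
rewrite -[N'.+3%:R]natr1 -[N'.+2%:R]natr1 -[k.+2%:R]natr1 -[N'.+1%:R]natr1 -[k.+1%:R]natr1 => h.
rewrite (_ : N'%:R + 1 + 1 + 1 - 2 = N'%:R + 1); last by ring.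
rewrite h; ring.
Qed.

(** A label [r] other than [i] and [j] lies outside a share [(m - 1) / (N - 2)] of the sets [C],
    whence the factor [N - 2]. Its total coefficient is [m (m - 1) + n (n - 1) = N (N - 1) - 2 n
    m]. *)
Lemma sum_pair_free_spread i j : i != j ->
  (N - 2) * (\sum_(C : {set T} | pair_free k.+1 i j C)
   (n * m * (2 * `|b i - b j| ^+ 3)
    + (m * (\sum_(r | [&& r \notin C, r != i & r != j]) spread b i j r)
    + n * (\sum_(r in C) spread b i j r)))) =
  M * ((N - 2) * (2 * n * m) * `|b i - b j| ^+ 3
   + (N * (N - 1) - 2 * n * m) * (\sum_r spread b i j r - 2 * `|b i - b j| ^+ 3)).
Proof.
move=> ij; pose Q := 'C(#|T| - 3, k.+1)%:R : R.
have QE : (N - 2) * Q = (m - 1) * M := card_pair_free_avoid_natmul.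
have -> : \sum_r spread b i j r - 2 * `|b i - b j| ^+ 3 =
    \sum_(r | (r != i) && (r != j)) spread b i j r.
  rewrite (bigD1 i)//= (bigD1 j)/=; last by rewrite eq_sym.
  by rewrite spread_diagl spread_diagr; ring.
set S := \sum_(r | (r != i) && (r != j)) spread b i j r.
have E1 : \sum_(C : {set T} | pair_free k.+1 i j C)
    \sum_(r | [&& r \notin C, r != i & r != j]) spread b i j r = Q * S.
  rewrite (exchange_big_dep (fun r => (r != i) && (r != j)))/=; last first.
    by move=> C r _ /and3P[_ -> ->].
  rewrite mulr_sumr; apply: eq_bigr => r /andP[ri rj].
  rewrite (eq_bigl (mem [pred C : {set T} | pair_free k.+1 i j C && (r \notin C)])).
    by rewrite sumr_const card_pair_free_avoid// mulr_natl.
  by move=> C; rewrite ri rj !andbT.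
have E2 : \sum_(C : {set T} | pair_free k.+1 i j C)
    \sum_(r in C) spread b i j r = (M - Q) * S.
  rewrite mulrBl -E1; apply/eqP; rewrite eq_sym subr_eq -big_split/=; apply/eqP.
  rewrite -[M]/(_%:R) -(card_pair_free ij) mulr_natl -sumr_const.
  apply: eq_bigr => C /and3P[_ iC jC].
  rewrite /S (bigID (mem C))/=; congr (_ + _); apply: eq_bigl => r.
    have [rC|] := boolP (r \in C); last by rewrite andbF.
    by rewrite andbT; apply/andP; split; [apply: contraNneq iC|apply: contraNneq jC] => <-.
  by rewrite andbC.
have E0 x : \sum_(C : {set T} | pair_free k.+1 i j C) x = M * x.
  by rewrite -(card_pair_free ij) mulr_natl -sumr_const.
rewrite !big_split/= E0 -!mulr_sumr E1 E2.
transitivity ((N - 2) * M * (n * m * (2 * `|b i - b j| ^+ 3))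
  + S * (m * ((N - 2) * Q) + n * ((N - 2) * M - (N - 2) * Q))); first by ring.
by rewrite QE; ring.
Qed.

Lemma exchange_defect_le i j :
  (N - 2) * `|(b i - b j) ^+ 2 * (n * m * (\sum_(B : {set T} | #|B| == k.+2) K (w B)))
  - N * (N - 1) * (\sum_(C : {set T} | pair_free k.+1 i j C)
      (b i - b j) * (H (w C + b i) - H (w C + b j)))| <=
  M * ((N - 2) * (2 * n * m) * `|b i - b j| ^+ 3
   + (N * (N - 1) - 2 * n * m) * (\sum_r spread b i j r - 2 * `|b i - b j| ^+ 3)).
Proof.
have N2 : 0 <= N - 2 by rewrite subr_ge0 ler_nat; move: kT; lia.
have m0 : 0 <= m by apply: le_trans m_ge1.
have [->|ij] := eqVneq i j.
  rewrite [X in N * (N - 1) * X]big1 => [|C _]; last by rewrite subrr mul0r.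
  rewrite [X in X - 2 * _]big1 => [|r _]; last by rewrite /spread subrr normr0 mul0r.
  by rewrite subrr normr0 !expr0n/= !(mul0r, mulr0, subr0, addr0) normr0 mulr0.
rewrite exchange_defect// -sum_pair_free_spread//; apply: ler_wpM2l => //.
apply: le_trans (ler_norm_sum _ _ _) _; apply: ler_sum => C /and3P[_ iC jC].
have bound u r : `|sqn (w C + b i - u) - sqn (w C + b j - u)| =
    `|sqn (b i - b r) - sqn (b j - b r)| -> `|e i j C u| <= spread b i j r.
  by move=> E; rewrite /spread -E; exact: taylor_defect_le.
have bound1 r : r \notin C -> `|e i j C (w (r |: C))| <= spread b i j r.
  move=> rC; apply: bound; rewrite subset_sumU1//.
  by congr `|sqn _ - sqn _|; ring.
have bound2 r : r \in C -> `|e i j C (w (i |: (j |: C :\ r)))| <= spread b i j r.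
  move=> rC; apply: bound.
  have jC' : j \notin C :\ r by rewrite !inE negb_and jC orbT.
  have iC' : i \notin j |: C :\ r by rewrite !inE (negbTE ij) negb_and iC orbT.
  rewrite !subset_sumU1// subset_sumD1//.
  (* The reference point is now [w C + b i + b j - b r], so [i] and [j] trade places up to sign, and
     [sqn] is odd. *)
  rewrite (_ : w C + b i - _ = - (b j - b r)); last by ring.
  rewrite (_ : w C + b j - _ = - (b i - b r)); last by ring.
  by rewrite !sqnN opprK addrC.
apply: le_trans (ler_normD _ _) _; apply: lerD.
  rewrite normrM ger0_norm ?mulr_ge0// ler_wpM2l ?mulr_ge0//.
  apply: le_trans (ler_normD _ _) _; rewrite mulr_natl mulr2n; apply: lerD.
    by rewrite -spread_diagl bound1.
  by rewrite -spread_diagr bound1.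
apply: le_trans (ler_normD _ _) _; apply: lerD; rewrite normrM ger0_norm//; apply: ler_wpM2l => //.
  apply: le_trans (ler_norm_sum _ _ _) _; apply: ler_sum => r /and3P[rC _ _].
  exact: bound1.
by apply: le_trans (ler_norm_sum _ _ _) _; apply: ler_sum => r; exact: bound2.
Qed.

Hypothesis b2 : n * m * (\sum_i b i ^+ 2) = N * (N - 1).

(** The hypothesis [b2] is unit variance of the sample sum: it makes the weights [(b i - b j) ^+ 2]
    of [exchange_defect] match the factor of [sum_subsets_exchange]. The claim then follows by
    summing the defects over [i] and [j]. *)
Lemma stein_sample_le :
  \sum_(B : {set T} | #|B| == k.+2) (K (w B) - w B * H (w B)) <= 4 * beta * M.
Proof.
rewrite sumrB; set SK := \sum_(B : {set T} | _) _; set SH := \sum_(B : {set T} | _) _.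
have N4 : 4 <= N by rewrite ler_nat; move: kT; lia.
have n1 : 1 <= n by rewrite ler1n.
have beta0 : 0 <= beta by apply: sumr_ge0 => i _; rewrite exprn_ge0.
have M0 : 0 <= M by [].
pose X i j := \sum_(C : {set T} | pair_free k.+1 i j C)
   (b i - b j) * (H (w C + b i) - H (w C + b j)).
pose S3 := \sum_i \sum_j `|b i - b j| ^+ 3.
pose ST := \sum_i \sum_j \sum_r spread b i j r.
have lin (f g : T -> T -> R) x y :
    (\sum_i \sum_j f i j) * x - y * (\sum_i \sum_j g i j) =
    \sum_i \sum_j (f i j * x - y * g i j).
  rewrite mulr_suml mulr_sumr -sumrB; apply: eq_bigr => i _.
  by rewrite mulr_suml mulr_sumr -sumrB.
have E : 2 * N * (N * (N - 1)) * (SK - SH) =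
    \sum_i \sum_j ((b i - b j) ^+ 2 * (n * m * SK) - N * (N - 1) * X i j).
  transitivity ((\sum_i \sum_j (b i - b j) ^+ 2) * (n * m * SK)
      - N * (N - 1) * \sum_i \sum_j X i j).
    rewrite (sum_dist2 b0) -(sum_subsets_exchange b0) -/SH -b2; ring.
  exact: lin.
have lin2 (f g : T -> T -> R) x y :
    M * (x * (\sum_i \sum_j f i j) + y * ((\sum_i \sum_j g i j) - 2 * (\sum_i \sum_j f i j))) =
    \sum_i \sum_j M * (x * f i j + y * (g i j - 2 * f i j)).
  rewrite [RHS](eq_bigr (fun i => M * (x * (\sum_j f i j) + y * ((\sum_j g i j) - 2 * (\sum_j f i j))))).
    by rewrite -mulr_sumr big_split/= -!mulr_sumr sumrB -mulr_sumr.
  by move=> i _; rewrite -mulr_sumr big_split/= -!mulr_sumr sumrB -mulr_sumr.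
have le1 : (N - 2) * (2 * N * (N * (N - 1)) * (SK - SH)) <=
    M * ((N - 2) * (2 * n * m) * S3 + (N * (N - 1) - 2 * n * m) * (ST - 2 * S3)).
  rewrite E /S3 /ST.
  rewrite lin2.
  rewrite mulr_sumr; apply: ler_sum => i _; rewrite mulr_sumr; apply: ler_sum => j _.
  apply: le_trans (exchange_defect_le i j); apply: ler_wpM2l; last exact: ler_norm.
  lra.
have S3le : S3 <= 4 * N * beta := sum_dist3 b0.
have STle : ST <= 6 * N ^+ 2 * beta := sum_spread b0.
have m1 := m_ge1.
(* [S3] also occurs with a minus sign, so it is collected before the moment bounds are inserted;
   [c0] and [c1] are the signs of the resulting coefficients of [S3] and [ST]. *)
have c0 : 0 <= 2 * N * (n * m - (N - 1)).
  rewrite (_ : n * m - (N - 1) = (n - 1) * (m - 1)); last by ring.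
  by rewrite !mulr_ge0//; lra.
have c1 : 0 <= N * (N - 1) - 2 * n * m.
  rewrite (_ : N * (N - 1) - 2 * n * m = n * (n - 1) + m * (m - 1)); last by ring.
  by rewrite addr_ge0// mulr_ge0//; lra.
have le2 : M * ((N - 2) * (2 * n * m) * S3 + (N * (N - 1) - 2 * n * m) * (ST - 2 * S3))
   <= M * (2 * N * (n * m - (N - 1)) * (4 * N * beta)
      + (N * (N - 1) - 2 * n * m) * (6 * N ^+ 2 * beta)).
  rewrite ler_wpM2l// [X in X <= _](_ : _ = 2 * N * (n * m - (N - 1)) * S3
      + (N * (N - 1) - 2 * n * m) * ST); last by ring.
  by rewrite lerD// ler_wpM2l.
have q0 : 0 < 2 * N ^+ 2 * (N - 1) * (N - 2).
  by rewrite !mulr_gt0// ?exprn_gt0//; lra.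
rewrite -(ler_pM2l q0).
apply: (@le_trans _ _ (M * (2 * N * (n * m - (N - 1)) * (4 * N * beta)
      + (N * (N - 1) - 2 * n * m) * (6 * N ^+ 2 * beta)))).
  by apply: le_trans le2; apply: le_trans le1; rewrite le_eqVlt; apply/orP; left; apply/eqP; ring.
(* This is exactly the slack between the two sides; it is nonnegative because [N] is at least 4. *)
have pos : 0 <= M * beta * N ^+ 2 * ((N - 1) * (2 * N - 8) + 4 * (n * m)).
  by rewrite !mulr_ge0 ?sqr_ge0// addr_ge0 ?mulr_ge0//; lra.
rewrite -subr_ge0; apply: le_trans pos _; rewrite le_eqVlt; apply/orP; left; apply/eqP.
ring.
Qed.

End sample_bound.

(** * Simple random samples *)

Section simple_random_sample_law.
Context {R : realType} {d : measure_display} {T : measurableType d}.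
Variables (P : probability T R) (N n : nat) (S : {RV P >-> {set 'I_N}}).

Let mS (A : set {set 'I_N}) : measurable (S @^-1` A).
Proof. by rewrite -[X in measurable X]setTI; exact: measurable_funP. Qed.

Lemma probability_sample (Q : pred {set 'I_N}) :
  (P (S @^-1` [set B | Q B]) = \sum_(B : {set 'I_N} | Q B) P (S @^-1` [set B]))%E.
Proof.
have -> : S @^-1` [set B | Q B] = \bigcup_(B in [set` Q]) (S @^-1` [set B]).
  apply/seteqP; split=> x /=; first by move=> QS; exists (S x).
  by case=> B /= QB ->.
rewrite measure_fin_bigcup; [|exact: finite_finset|..]; last 2 first.
- by move=> A B _ _ [x [<- <-]].
- by move=> B _; exact: mS.
rewrite -(@bigfs _ _ _ _ (index_enum _))//; first exact: index_enum_uniq.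
by move=> B _; rewrite mem_index_enum.
Qed.

Hypothesis srs : simple_random_sample n S.
Hypothesis nN : (n <= N)%N.

Lemma probability_sample_size : P (S @^-1` [set B : {set 'I_N} | #|B| == n]) = 1%E.
Proof.
have C0 : 'C(N, n)%:R != 0 :> R by rewrite pnatr_eq0 -lt0n bin_gt0.
rewrite probability_sample (eq_bigr (fun=> ('C(N, n)%:R^-1)%:E)); last first.
  by move=> B /eqP Bn; exact: srs.
rewrite sumEFin sumr_const.
have -> : #|[pred B : {set 'I_N} | #|B| == n]| = 'C(N, n).
  by rewrite -[in RHS](card_ord N) -card_draws; apply: eq_card => B; rewrite !inE.
by rewrite -[_ *+ _]mulr_natl divff.
Qed.

Lemma probability_sample_card (Q : pred {set 'I_N}) :
  P (S @^-1` [set B | Q B]) =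
  ('C(N, n)%:R^-1 * \sum_(B : {set 'I_N} | #|B| == n) (Q B)%:R)%:E.
Proof.
rewrite probability_sample (bigID (fun B : {set 'I_N} => #|B| == n))/=.
rewrite -[X in (_ + X)%E]probability_sample [X in (_ + X)%E](_ : _ = 0%E).
  rewrite adde0 mulr_sumr -sumEFin big_mkcondl/=.
  apply: eq_bigr => B /eqP Bn; case: (Q B); last by rewrite mulr0.
  by rewrite mulr1; exact: srs.
apply/eqP; rewrite -measure_le0.
apply: (@le_trans _ _ (P (~` (S @^-1` [set B : {set 'I_N} | #|B| == n])))).
  by apply: le_measure; rewrite ?inE//; [exact: measurableC|move=> x /= /andP[_ /negP]].
by rewrite probability_setC// probability_sample_size subee.
Qed.

End simple_random_sample_law.

(** * The standardized population and the normal approximation *)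

Section standardized_population.
Context {R : realType} {N : nat}.
Variables (n : nat) (a : 'I_N -> R).
Local Notation s2 := (\sum_i (a i - pop_mean a) ^+ 2).

Definition standardized (i : 'I_N) : R := (a i - pop_mean a) / sample_sigma n a.

Lemma sum_deviations : (0 < N)%N -> \sum_i (a i - pop_mean a) = 0.
Proof.
move=> N0; rewrite sumrB sumr_const card_ord -[_ *+ _]mulr_natl /pop_mean.
by rewrite mulrA divff ?mul1r ?subrr// pnatr_eq0 -lt0n.
Qed.

Lemma sum_standardized : (0 < N)%N -> \sum_i standardized i = 0.
Proof. by move=> N0; rewrite -mulr_suml sum_deviations ?mul0r. Qed.

Lemma standardized_sumE (B : {set 'I_N}) : #|B| = n ->
  standardized_sum n a B = subset_sum standardized B.
Proof.
move=> Bn; rewrite /standardized_sum /subset_sum -mulr_suml sumrB sumr_const Bn.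
by rewrite /sample_sum /sample_mu mulr_natl.
Qed.

Hypothesis n0 : (0 < n)%N.
Hypothesis nN : (n < N)%N.
Hypothesis aneq : ~ (forall i j, a i = a j).

Lemma sum_deviations2_gt0 : 0 < s2.
Proof.
rewrite lt_neqAle sumr_ge0 ?andbT => [|i _]; last exact: sqr_ge0.
apply/negP; rewrite eq_sym => /eqP/psumr_eq0P E; apply: aneq => i j.
have {}E k : a k = pop_mean a.
  by apply/eqP; rewrite -subr_eq0 -sqrf_eq0; apply/eqP/E => // l _; exact: sqr_ge0.
by rewrite !E.
Qed.

Let nm_gt0 : 0 < n%:R * (N%:R - n%:R) / (N%:R * (N%:R - 1)) :> R.
Proof.
by rewrite divr_gt0 ?mulr_gt0 ?subr_gt0 ?ltr_nat ?ltr0n ?ltr1n//; lia.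
Qed.

Lemma sample_sigma2_gt0 : 0 < sample_sigma2 n a.
Proof. by rewrite mulr_gt0// sum_deviations2_gt0. Qed.

Lemma sample_sigma_gt0 : 0 < sample_sigma n a.
Proof. by rewrite sqrtr_gt0 sample_sigma2_gt0. Qed.

Lemma sum_standardized2 :
  n%:R * (N%:R - n%:R) * \sum_i standardized i ^+ 2 = N%:R * (N%:R - 1).
Proof.
under eq_bigr do rewrite exprMn.
rewrite -mulr_suml exprVn sqr_sqrtr ?ltW ?sample_sigma2_gt0//.
have := sum_deviations2_gt0; set s := s2 => s0; rewrite /sample_sigma2 -/s.
have N0 : N%:R != 0 :> R by rewrite pnatr_eq0; lia.
have N1 : N%:R - 1 != 0 :> R by rewrite subr_eq0 pnatr_eq1; lia.
have n1 : n%:R != 0 :> R by rewrite pnatr_eq0; lia.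
have nN' : N%:R - n%:R != 0 :> R by rewrite subr_eq0 eqr_nat; lia.
by field; rewrite N0 N1 n1 nN' gt_eqF.
Qed.

Lemma sum_standardized3 :
  \sum_i `|standardized i| ^+ 3 = pop_a3 a / sample_sigma n a ^+ 3.
Proof.
rewrite /pop_a3 mulr_suml; apply: eq_bigr => i _.
rewrite /standardized normrM normfV exprMn exprVn [`|sample_sigma _ _|]gtr0_norm//.
exact: sample_sigma_gt0.
Qed.

End standardized_population.

Theorem theorem5p1 (R : realType) (d : measure_display) (T : measurableType d)
    (P : probability T R) (N n : nat) (a : 'I_N -> R)
    (S : {RV P >-> {set 'I_N}}) :
  (2 < n < N - 1)%N ->
  ~ (forall i j : 'I_N, a i = a j) ->
  simple_random_sample n S ->
  (L1_dist (cdf (standardized_sum n a \o S : {RV P >-> R})) (@std_normal_cdf R) <=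
    (4 * pop_a3 a / sample_sigma n a ^+ 3
     * (n%:R * (N%:R - n%:R) / (N%:R * (N%:R - 1)))
     * (1 + n%:R / N%:R) ^+ 2)%:E)%E.
Proof.
case: n => [//|[//|k]] /andP[k0 kN] aneq srs; set n := k.+2 in srs *.
have N0 : (0 < N)%N by lia.
have nN : (n < N)%N by rewrite /n; lia.
pose b := @standardized R N n a.
pose C : R := 'C(N, n)%:R.
have C0 : 0 < C by rewrite ltr0n bin_gt0 ltnW.
have Ci0 : 0 <= C^-1 by rewrite invr_ge0 ltW.
have [H [K [taylor L1E]]] := stein_L1 (fun B : {set 'I_N} => #|B| == n) (subset_sum b) Ci0.
have L1 : L1_dist (cdf (standardized_sum n a \o S : {RV P >-> R})) (@std_normal_cdf R) =
    (C^-1 * \sum_(B : {set 'I_N} | #|B| == n)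
      (K (subset_sum b B) - subset_sum b B * H (subset_sum b B)))%:E.
  rewrite -L1E; apply: eq_integral => t _; rewrite std_normal_cdfE.
  have -> : cdf (standardized_sum n a \o S : {RV P >-> R}) t =
      P (S @^-1` [set B | standardized_sum n a B <= t]).
    by rewrite /cdf /distribution/= /pushforward; congr (P _).
  rewrite (probability_sample_card srs)//; last exact: ltnW.
  rewrite -EFinB abse_EFin -[in RHS](ger0_norm Ci0) -normrM; congr (`|_|%:E).
  rewrite sumrB mulrBr; congr (_ - _).
    by congr (_ * _); apply: eq_bigr => B /eqP Bn; rewrite standardized_sumE.
  rewrite sumr_const (_ : #|_| = 'C(N, n)); last first.
    by rewrite -[in RHS](card_ord N) -card_draws; apply: eq_card => B; rewrite !inE.
  by rewrite -[_ *+ _]mulr_natl mulKf ?gt_eqF.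
have cT : #|'I_N| = N := card_ord N.
rewrite L1 lee_fin.
have b0 : \sum_i b i = 0 by exact: sum_standardized.
have kT : (k.+4 <= #|'I_N|)%N by rewrite cT; lia.
have b2 : k.+2%:R * (#|'I_N|%:R - k.+2%:R) * \sum_i b i ^+ 2 = #|'I_N|%:R * (#|'I_N|%:R - 1) :> R.
  by rewrite cT; exact: sum_standardized2.
have := stein_sample_le b0 taylor kT b2.
have := card_pair_free_natmul (R := R) kT; rewrite cT -/n -/C.
set M : R := 'C(N - 2, k.+1)%:R => ME le1.
set c := n%:R * (N%:R - n%:R) / (N%:R * (N%:R - 1)).
(* The share of the samples of size [n] that contain one given label and omit another. *)
have MC : C^-1 * M = c.
  apply: (mulfI (lt0r_neq0 C0)); rewrite mulVKf ?gt_eqF// /c.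
  have D0 : N%:R * (N%:R - 1) != 0 :> R.
    by rewrite mulf_neq0 ?subr_eq0 ?pnatr_eq0 ?pnatr_eq1//; lia.
  by rewrite mulrA; apply/esym/(canLR (mulfK D0)); rewrite mulrC -ME mulrC.
apply: (@le_trans _ _ (C^-1 * (4 * (\sum_i `|b i| ^+ 3) * M))).
  by apply: ler_wpM2l => //; exact: le1.
rewrite mulrCA MC sum_standardized3//.
rewrite [leRHS](_ : _ = 4 * (pop_a3 a / sample_sigma n a ^+ 3) * c
  * (1 + n%:R / N%:R) ^+ 2); last by rewrite !mulrA.
(* The estimate obtained from [stein_sample_le] has 1 in place of the last factor, which is at least
   1. *)
rewrite ler_peMr//; last by rewrite exprn_ege1// lerDl divr_ge0.
apply: mulr_ge0; last by rewrite -MC mulr_ge0.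
apply: mulr_ge0 => //; rewrite -sum_standardized3//.
by apply: sumr_ge0 => i _; exact: exprn_ge0.
Qed.
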